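(* Let $\eta=(e(X),\mu_0(X),\mu_1(X))$, and assume strong ignorability: $(Y^0,Y^1)\perp\!\!\!\perp A\mid X$ and $0<e(x)<1$ for all $x$. Suppose the propensity score $e(\cdot)$ is unknown. (a) If in addition monotonicity $Y^0\le Y^1$ holds (so that $\gamma=(\bar\mu_1-\bar\mu_0)/\bar{\bar\mu}_0$), then the efficient influence function of $\gamma$ is \begin{align*} \phi_\gamma(Y,A,X;\eta)&=\frac{1}{\bar{\bar\mu}_0}\frac{A}{e(X)}(1-e(X))(Y-\mu_1(X))-\frac{\bar{\bar\mu}_1}{\bar{\bar\mu}_0^2}(1-A)(Y-\mu_0(X))\\ &\quad+\Big[\frac{1}{\bar{\bar\mu}_0}(1-\mu_1(X))-\frac{\bar{\bar\mu}_1}{\bar{\bar\mu}_0^2}(1-\mu_0(X))\Big](A-e(X))\\ &\quad+\Big[\frac{\bar{\bar\mu}_1}{\bar{\bar\mu}_0^2}(1-\mu_0(X))-\frac{1}{\bar{\bar\mu}_0}(1-\mu_1(X))\Big](1-e(X))\\ &=\frac{1}{\bar{\bar\mu}_0}\frac{A}{e(X)}(1-e(X))(Y-\mu_1(X))-\frac{1-\gamma}{\bar{\bar\mu}_0}(1-A)(Y-\mu_0(X))\\ &\quad+\frac{\mu_0(X)-\mu_1(X)+\gamma(1-\mu_0(X))}{\bar{\bar\mu}_0}(A-1), \end{align*} and the associated semiparametric efficiency bound of $\gamma$ is $\mathbb{V}(\phi_\gamma(Y,A,X;\eta))=\mathbb{E}[\phi_\gamma^2(Y,A,X;\eta)]$.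 (b) If instead in addition conditional independence $Y^0\perp\!\!\!\perp Y^1\mid X$ holds (so that $\gamma=(\bar\mu_1-\bar\mu)/\bar{\bar\mu}_0$), then the efficient influence function of $\gamma$ is \begin{align*} \varphi_\gamma(Y,A,X;\eta)&=\frac{1}{\bar{\bar\mu}_0}\frac{A}{e(X)}(1-e(X))(Y-\mu_1(X))(1-\mu_0(X))+(1-A)\Big(\frac{\bar\mu_1-\bar\mu}{\bar{\bar\mu}_0^2}-\frac{1}{\bar{\bar\mu}_0}\mu_1(X)\Big)(Y-\mu_0(X))\\ &\quad+\Big(\frac{\bar\mu_1-\bar\mu}{\bar{\bar\mu}_0^2}-\frac{1}{\bar{\bar\mu}_0}\mu_1(X)\Big)(1-\mu_0(X))(A-e(X))\\ &\quad+\Big(\frac{1}{\bar{\bar\mu}_0}\mu_1(X)-\frac{\bar\mu_1-\bar\mu}{\bar{\bar\mu}_0^2}\Big)(1-\mu_0(X))(1-e(X))\\ &=\frac{1}{\bar{\bar\mu}_0}\frac{A}{e(X)}(1-e(X))(Y-\mu_1(X))(1-\mu_0(X))+\Big(\frac{\gamma}{\bar{\bar\mu}_0}-\frac{1}{\bar{\bar\mu}_0}\mu_1(X)\Big)(1-Y)(A-1), \end{align*} and the associated semiparametric efficiency bound of $\gamma$ is $\mathbb{V}(\varphi_\gamma(Y,A,X;\eta))=\mathbb{E}[\varphi_\gamma^2(Y,A,X;\eta)]$.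
   Context: Setting: $X$ is a $p$-dimensional covariate vector, $A\in\{0,1\}$ a binary cause, $Y\in\{0,1\}$ a binary outcome, $Y^0,Y^1\in\{0,1\}$ the potential outcomes, with $Y=AY^1+(1-A)Y^0$. The propensity score is $e(x)=\mathbb{P}(A=1\mid X=x)$; the outcome regressions are $\mu_a(x)=\mathbb{P}(Y=1\mid X=x,A=a)$, $a=0,1$. Constants: $\bar\mu_a=\mathbb{E}[\mu_a(X)(1-e(X))]$ and $\bar{\bar\mu}_a=\mathbb{E}[(1-\mu_a(X))(1-e(X))]$ for $a=0,1$, and $\bar\mu=\mathbb{E}[\mu_1(X)\mu_0(X)(1-e(X))]$. The probability of sufficient causation is $\gamma=\mathbb{P}(Y^1=1\mid A=0,Y=0)$, where $\mathbb{P}(A=0,Y=0)>0$. $\mathbb{V}$ denotes variance. Efficient influence function: write $f_a(y\mid x)$ for the conditional density of $Y^a$ given $X=x$ and $f(x)$ for the density of $X$. The observed-data density of $(Y,A,X)$ is $[f_1(y\mid x)e(x)]^a[f_0(y\mid x)(1-e(x))]^{1-a}f(x)$. A regular parametric submodel indexes $f_1,f_0,e,f$ by a parameter $\theta$ (truth at $\theta_0$), with score $s(y,a,x;\theta)$; $\gamma(\theta)$ is the identification formula for $\gamma$ (stated in each part) evaluated at the submodel. The tangent space is $$\mathcal{T}=\{a\,s_1(y\mid x)+(1-a)s_0(y\mid x)+\alpha(x)(a-e(x))+s(x)\},$$ where $\int s_a(y\mid x)f_a(y\mid x)\,dy=0$ for $a=0,1$, $\int s(x)f(x)\,dx=0$,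 and $\alpha$ is an arbitrary square-integrable measurable function. An influence function of $\gamma$ is a mean-zero function $\psi(Y,A,X)$ with $\partial\gamma(\theta)/\partial\theta|_{\theta=\theta_0}=\mathbb{E}[\psi(Y,A,X)\,s(Y,A,X;\theta_0)]$ for every regular parametric submodel; the efficient influence function is the influence function belonging to $\mathcal{T}$, and the semiparametric efficiency bound is its variance.
   Formalization: As e(x) has no positive lower bound, E[ψs] may not exist; the influence-function identity is required for regular submodels (differentiable in θ with dominated derivatives, square-integrable score) with ψs integrable, which is all of them when ψ has finite variance. *)

(* Defs.v *)
From HB Require Import structures.
From mathcomp Require Import all_boot all_order all_algebra.
From mathcomp Require Import all_classical all_reals all_analysis.
Set Implicit Arguments.
Unset Strict Implicit.
Unset Printing Implicit Defensive.
Import Order.TTheory GRing.Theory Num.Theory.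
Import numFieldNormedType.Exports.

Local Open Scope classical_set_scope.
Local Open Scope ring_scope.

(* Binary variables are valued in bool, and enter formulas as b%:R. *)

Section conditioning.
Context {d d' : measure_display} {Omega : measurableType d}
  {T : measurableType d'} {R : realType}.
Variable P : probability Omega R.

(* g is a version of the conditional probability P(E | Z = z). *)
Definition is_cond_prob (Z : Omega -> T) (E : set Omega) (g : T -> R) : Prop :=
  measurable_fun setT g /\
  forall B : set T, measurable B ->
    P (E `&` Z @^-1` B) = (\int[P]_(w in Z @^-1` B) (g (Z w))%:E)%E.

(* Conditional independence given Z of two finitely valued variables.
   Versions of conditional probabilities exist and are almost surely unique,
   so it does not matter which versions gu, gv are used. *)
Definition cond_indep (Z : Omega -> T) (S1 S2 : finType)
    (U : Omega -> S1) (V : Omega -> S2) : Prop :=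
  forall (u : S1) (v : S2), exists gu gv : T -> R,
    [/\ is_cond_prob Z (U @^-1` [set u]) gu,
        is_cond_prob Z (V @^-1` [set v]) gv &
        is_cond_prob Z (U @^-1` [set u] `&` V @^-1` [set v])
          (fun z => gu z * gv z)].

Definition is_cond_pmf (Z : Omega -> T) (U : Omega -> bool)
    (f : bool -> T -> R) : Prop :=
  [/\ forall y, is_cond_prob Z (U @^-1` [set y]) (f y),
      forall y x, 0 <= f y x &
      forall x, f true x + f false x = 1].

Definition is_density (nu : set T -> \bar R) (Z : Omega -> T) (f : T -> R)
    : Prop :=
  [/\ measurable_fun setT f, forall x, 0 <= f x &
      forall B : set T, measurable B ->
        P (Z @^-1` B) = (\int[nu]_(x in B) (f x)%:E)%E].

End conditioning.

(* The variation-independent components of the law of (Y, A, X):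
   outd a y x is f_a(y | x), prop x is e(x) and covd x is f(x), the latter a
   density with respect to a dominating measure nu on the covariate space. *)
Record components (T : Type) (R : Type) := Components {
  outd : bool -> bool -> T -> R ;
  prop : T -> R ;
  covd : T -> R }.

Definition obs_density (T : Type) (R : realType) (c : components T R)
    (y a : bool) (x : T) : R :=
  (if a then outd c true y x * prop c x else outd c false y x * (1 - prop c x))
  * covd c x.

Section semiparametric.
Context {d d' : measure_display} {Omega : measurableType d}
  {T : measurableType d'} {R : realType}.
Variables (P : probability Omega R) (nu : {measure set T -> \bar R}).
Variables (Y A : Omega -> bool) (X : Omega -> T).
(* c0 collects the components of the true law. *)
Variable c0 : components T R.

Definition in_model (c : components T R) : Prop :=
  [/\ (forall a y, measurable_fun setT (outd c a y)) /\
        measurable_fun setT (prop c) /\ measurable_fun setT (covd c),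
      forall a x, outd c a true x + outd c a false x = 1 /\
                  (forall y, 0 <= outd c a y x),
      forall x, 0 < prop c x < 1,
      forall x, 0 <= covd c x &
      (\int[nu]_x (covd c x)%:E = 1)%E].

Definition partial (k : nat) (j : 'I_k) (g : 'rV[R]_k -> R) (t : 'rV[R]_k) : R :=
  'D_(delta_mx 0 j) g t.

(* Derivative in theta_j of the log-density of (Y, A, X), written as the
   derivative of the density over the density: the two agree where the density
   is positive, and it is positive almost surely at (Y, A, X). *)
Definition score (k : nat) (M : 'rV[R]_k -> components T R) (t : 'rV[R]_k)
    (j : 'I_k) (y a : bool) (x : T) : R :=
  partial j (fun t' => obs_density (M t') y a x) t / obs_density (M t) y a x.

Definition at_obs (psi : bool -> bool -> T -> R) (w : Omega) : R :=
  psi (Y w) (A w) (X w).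

(* Regularity of M at t0: M passes through the truth at t0, its score has finite
   variance, and near t0 it is differentiable in theta with the domination that
   permits differentiating integrals over x under the integral sign. *)
Definition regular_submodel (k : nat) (M : 'rV[R]_k -> components T R)
    (t0 : 'rV[R]_k) : Prop :=
  [/\ M t0 = c0,
      forall j, at_obs (score M t0 j) \in Lfun P 2%:E &
      exists G : T -> R, nu.-integrable setT (EFin \o G) /\
        \forall t \near t0, in_model (M t) /\
          forall (j : 'I_k) (x : T),
          [/\ forall a y, derivable (fun t' => outd (M t') a y x) t (delta_mx 0 j) /\
                `|partial j (fun t' => outd (M t') a y x) t| * covd (M t) x <= G x,
              derivable (fun t' => prop (M t') x) t (delta_mx 0 j) /\
                `|partial j (fun t' => prop (M t') x) t| * covd (M t) x <= G x &
              derivable (fun t' => covd (M t') x) t (delta_mx 0 j) /\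
                `|partial j (fun t' => covd (M t') x) t| <= G x]].

(* The elements a s_1(y|x) + (1-a) s_0(y|x) + alpha(x) (a - e(x)) + s(x). *)
Definition in_tangent_space (psi : bool -> bool -> T -> R) : Prop :=
  exists (sY : bool -> bool -> T -> R) (alpha s : T -> R),
    [/\ (forall a y, measurable_fun setT (sY a y)) /\
          (forall a x, \sum_(y : bool) sY a y x * outd c0 a y x = 0),
        measurable_fun setT alpha /\ (alpha \o X) \in Lfun P 2%:E,
        [/\ measurable_fun setT s,
            nu.-integrable setT (fun x => (s x * covd c0 x)%:E) &
            \int[nu]_x (s x * covd c0 x) = 0] &
        {ae P, forall w, at_obs psi w =
           (A w)%:R * sY true (Y w) (X w)
           + (1 - (A w)%:R) * sY false (Y w) (X w)
           + alpha (X w) * ((A w)%:R - prop c0 (X w)) + s (X w)}].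

(* The requirement bears on all regular submodels for which E[psi s] is defined.
   Scores being in L^2, these are all regular submodels as soon as psi is in L^2,
   and for any integrable psi they include those with bounded score.  No lower
   bound on e being assumed, a psi of infinite variance cannot be excluded. *)
Definition influence_function (Gamma : components T R -> R)
    (psi : bool -> bool -> T -> R) : Prop :=
  [/\ forall y a, measurable_fun setT (psi y a),
      at_obs psi \in Lfun P 1%E,
      ('E_P[at_obs psi] = 0)%E &
      forall (k : nat) (M : 'rV[R]_k -> components T R) (t0 : 'rV[R]_k),
        regular_submodel M t0 -> forall j : 'I_k,
        (fun w => at_obs psi w * at_obs (score M t0 j) w) \in Lfun P 1%E ->
        is_derive t0 (delta_mx 0 j) (fun t => Gamma (M t))
          (fine ('E_P[fun w => (at_obs psi w * at_obs (score M t0 j) w)%R])%E)].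

Definition efficient_influence_function (Gamma : components T R -> R)
    (psi : bool -> bool -> T -> R) : Prop :=
  [/\ influence_function Gamma psi,
      in_tangent_space psi &
      forall psi', influence_function Gamma psi' -> in_tangent_space psi' ->
        {ae P, forall w, at_obs psi' w = at_obs psi w}].

Definition efficiency_bound (Gamma : components T R -> R) (b : \bar R) : Prop :=
  exists2 psi, efficient_influence_function Gamma psi & b = 'V_P[at_obs psi]%E.

End semiparametric.

Section identification_formulas.
Context {d' : measure_display} {T : measurableType d'} {R : realType}.
Variable nu : {measure set T -> \bar R}.

Definition model_mean (c : components T R) (h : T -> R) : R :=
  \int[nu]_x (h x * covd c x).

(* Under the law with components c, mu_a(x) is outd c a true x. *)
Definition gamma_mono (c : components T R) : R :=
  (model_mean c (fun x => outd c true true x * (1 - prop c x))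
   - model_mean c (fun x => outd c false true x * (1 - prop c x)))
  / model_mean c (fun x => (1 - outd c false true x) * (1 - prop c x)).

Definition gamma_indep (c : components T R) : R :=
  (model_mean c (fun x => outd c true true x * (1 - prop c x))
   - model_mean c
       (fun x => outd c true true x * outd c false true x * (1 - prop c x)))
  / model_mean c (fun x => (1 - outd c false true x) * (1 - prop c x)).

End identification_formulas.

Section influence_functions.
Context {d d' : measure_display} {Omega : measurableType d}
  {T : measurableType d'} {R : realType}.
Variables (P : probability Omega R) (X : Omega -> T).
Variables (e : T -> R) (mu : bool -> T -> R).

Definition mub (a : bool) : R :=
  fine ('E_P[fun w => (mu a (X w) * (1 - e (X w)))%R])%E.

Definition mubb (a : bool) : R :=
  fine ('E_P[fun w => ((1 - mu a (X w)) * (1 - e (X w)))%R])%E.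

Definition mub10 : R :=
  fine ('E_P[fun w => (mu true (X w) * mu false (X w) * (1 - e (X w)))%R])%E.

Definition phi_mono (y a : bool) (x : T) : R :=
  (mubb false)^-1 * (a%:R / e x) * (1 - e x) * (y%:R - mu true x)
  - mubb true / mubb false ^+ 2 * (1 - a%:R) * (y%:R - mu false x)
  + ((mubb false)^-1 * (1 - mu true x)
     - mubb true / mubb false ^+ 2 * (1 - mu false x)) * (a%:R - e x)
  + (mubb true / mubb false ^+ 2 * (1 - mu false x)
     - (mubb false)^-1 * (1 - mu true x)) * (1 - e x).

Definition phi_mono_gamma (gamma : R) (y a : bool) (x : T) : R :=
  (mubb false)^-1 * (a%:R / e x) * (1 - e x) * (y%:R - mu true x)
  - (1 - gamma) / mubb false * (1 - a%:R) * (y%:R - mu false x)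
  + (mu false x - mu true x + gamma * (1 - mu false x)) / mubb false
    * (a%:R - 1).

Definition phi_indep (y a : bool) (x : T) : R :=
  (mubb false)^-1 * (a%:R / e x) * (1 - e x) * (y%:R - mu true x)
    * (1 - mu false x)
  + (1 - a%:R)
    * ((mub true - mub10) / mubb false ^+ 2 - (mubb false)^-1 * mu true x)
    * (y%:R - mu false x)
  + ((mub true - mub10) / mubb false ^+ 2 - (mubb false)^-1 * mu true x)
    * (1 - mu false x) * (a%:R - e x)
  + ((mubb false)^-1 * mu true x - (mub true - mub10) / mubb false ^+ 2)
    * (1 - mu false x) * (1 - e x).

Definition phi_indep_gamma (gamma : R) (y a : bool) (x : T) : R :=
  (mubb false)^-1 * (a%:R / e x) * (1 - e x) * (y%:R - mu true x)
    * (1 - mu false x)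
  + (gamma / mubb false - (mubb false)^-1 * mu true x)
    * (1 - y%:R) * (a%:R - 1).

End influence_functions.

(* Main.v *)
(* The influence function property is checked on densities: since the score times
   the density is the derivative of the density, E[psi s] is the integral over x of
   the sum over (y, a) of psi times that derivative, which agrees pointwise in x
   with the derivative of the integrand of the numerator minus gamma times the
   denominator.  The latter is differentiated under the integral sign.
   The tangent space is the space of all mean-zero functions, so for uniqueness it
   suffices to find, for every bounded mean-zero h, a regular submodel with score h.
   Two influence functions then have a difference delta orthogonal to
   h = sign delta - E[sign delta], whence E|delta| = 0. *)

Require Import Defs.
From mathcomp Require Import all_boot all_order all_algebra.
From mathcomp Require Import all_classical all_reals all_analysis.
From mathcomp Require Import measurable_realfun ring lra.
Import Order.TTheory GRing.Theory Num.Theory.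
Import numFieldNormedType.Exports.
Local Open Scope classical_set_scope.
Local Open Scope ring_scope.

Set Implicit Arguments.
Unset Strict Implicit.
Unset Printing Implicit Defensive.

(** Both parts come from one computation: the two identification formulas are quotients of integrals
    from a single family of integrands bilinear in the regressions, and one [gradient] with two
    parameters serves for both. Two obstacles shape the rest. Nothing keeps the propensity score
    away from 0, so the term in A/e(X) may fail to be square integrable. It is integrable because
    E[A/e(X)] = 1, but pairing with an arbitrary score is not automatic. This is why the direction
    in the uniqueness argument is the sign of the difference, which is bounded, and not the
    difference itself. Moreover every conditional probability is only a version: the regressions
    [mu] agree with the components of the truth almost surely along X. The gradient is therefore
    built from the components, where pointwise algebra is available, and the displayed formulas are
    treated as almost sure modifications of it. *)

(** * Integration of functions of X against a density *)

Section density.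
Context d d' (U : measurableType d) (T : measurableType d') (R : realType).
Variables (m : {measure set U -> \bar R}) (nu : {measure set T -> \bar R}).
Variables (X : U -> T) (E : set U) (q : T -> R).
Hypotheses (mX : measurable_fun setT X) (mE : measurable E).
Hypotheses (mq : measurable_fun setT q) (q0 : forall x, 0 <= q x).
Hypothesis mq_density : forall B : set T, measurable B ->
  m (E `&` X @^-1` B) = (\int[nu]_(x in B) (q x)%:E)%E.

Import HBNNSimple.

(** The set [E] lets one statement serve three laws of X: on the whole space, where [q] is the
    covariate density, on a cell of values of (Y, A), where [q] is [obs_density], and on one
    treatment arm. *)
Lemma ge0_integral_density (G : T -> \bar R) :
  measurable_fun [set: T] G -> (forall x, (0 <= G x)%E) ->
  (\int[m]_(w in E) G (X w) = \int[nu]_x (G x * (q x)%:E))%E.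
Proof.
move=> mG G0; pose h := nnsfun_approx measurableT mG.
have mEq : measurable_fun setT (EFin \o q) by exact/measurable_EFinP.
have mhX n : measurable_fun E (fun w => (h n (X w))%:E).
  apply/measurable_EFinP/measurable_funTS.
  exact: (measurableT_comp (@measurable_funPT _ _ _ _ (h n)) mX).
transitivity (limn (fun n => \int[m]_(w in E) (h n (X w))%:E))%E.
  rewrite -monotone_convergence//.
  - by apply: eq_integral => w _; apply/esym/cvg_lim => //; exact: cvg_nnsfun_approx.
  - by move=> n w _; rewrite lee_fin.
  - by move=> w _ a b ab; rewrite lee_fin; exact/lefP/nd_nnsfun_approx.
transitivity (limn (fun n => \int[nu]_x ((h n x)%:E * (q x)%:E)))%E; last first.
  rewrite -monotone_convergence//.
  - apply: eq_integral => x _; apply/cvg_lim => //.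
    by apply: cvgeZr => //; exact: cvg_nnsfun_approx.
  - by move=> n; apply: emeasurable_funM => //; exact/measurable_EFinP.
  - by move=> n x _; rewrite mule_ge0 ?lee_fin.
  - move=> x _ a b ab; rewrite lee_wpmul2r ?lee_fin//.
    exact/lefP/nd_nnsfun_approx.
(* Both sides are now limits over the same simple functions, so the hypothesis on [q] is needed on
   level sets only. *)
congr (limn _); apply/funext => n; move: (h n) (mhX n) => {mhX} {}h mh.
have mhr r : measurable (h @^-1` [set r]) by [].
have mXr r : measurable (X @^-1` (h @^-1` [set r])).
  by rewrite -[X in measurable X]setTI; exact: mX.
transitivity (\sum_(r \in range h) \int[m]_(w in E)
    (r%:E * (\1_(h @^-1` [set r]) (X w))%:E))%E.
  rewrite -ge0_integral_fsum//.
  - by apply: eq_integral => w _; rewrite fimfunE -fsumEFin.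
  - move=> r; apply: emeasurable_funM => //; apply/measurable_EFinP/measurable_funTS.
    by rewrite [X in measurable_fun _ X](_ : _ = \1_(X @^-1` (h @^-1` [set r]))).
  - by move=> r w _; rewrite -EFinM; exact: nnfun_muleindic_ge0.
transitivity (\sum_(r \in range h) \int[nu]_x
    (r%:E * ((\1_(h @^-1` [set r]) x)%:E * (q x)%:E)))%E; last first.
  rewrite -ge0_integral_fsum//.
  - apply: eq_integral => x _.
    rewrite [in RHS]fimfunE -fsumEFin// ge0_mule_fsuml.
      by apply: eq_fsbigr => r _; rewrite EFinM muleA.
    by move=> r; exact: nnfun_muleindic_ge0.
  - move=> r; apply: emeasurable_funM => //; apply: emeasurable_funM => //.
    exact/measurable_EFinP.
  - move=> r x _; rewrite muleA; apply: mule_ge0; last by rewrite lee_fin.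
    exact: nnfun_muleindic_ge0.
apply: eq_fsbigr => r; rewrite inE => -[x _ hxr].
have r0 : (0 <= r%:E)%E by rewrite lee_fin -hxr.
rewrite ge0_integralZl//; last first.
  apply/measurable_EFinP/measurable_funTS.
  by rewrite [X in measurable_fun _ X](_ : _ = \1_(X @^-1` (h @^-1` [set r]))).
rewrite ge0_integralZl//; last 2 first.
- by apply: emeasurable_funM => //; exact/measurable_EFinP.
- by move=> y _; rewrite mule_ge0 ?lee_fin.
congr (_ * _)%E.
transitivity (m (E `&` X @^-1` (h @^-1` [set r]))).
  by rewrite setIC -integral_indic.
rewrite mq_density//.
under [RHS]eq_integral do rewrite muleC.
rewrite integral_mkcond; apply: eq_integral => y _.
by rewrite epatch_indic.
Qed.

Lemma ge0_integral_density_in (B : set T) (G : T -> \bar R) : measurable B ->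
  measurable_fun [set: T] G -> (forall x, (0 <= G x)%E) ->
  (\int[m]_(w in E `&` X @^-1` B) G (X w) = \int[nu]_(x in B) (G x * (q x)%:E))%E.
Proof.
move=> mB mG G0; rewrite integral_mkcondr [RHS]integral_mkcond.
transitivity (\int[m]_(w in E) (G \_ B)%E (X w))%E.
  by apply: eq_integral => w _; rewrite !patchE (_ : (w \in _) = (X w \in B)).
rewrite ge0_integral_density.
- by apply: eq_integral => x _; rewrite !patchE; case: ifP; rewrite ?mul0e.
- apply/(measurable_restrictT _ _).1 => //; exact: measurable_funTS.
- by move=> x; rewrite patchE; case: ifP.
Qed.

(** Since [q] is nonnegative, multiplication by [q] commutes with taking positive and negative
    parts. *)
Lemma integral_density (G : T -> \bar R) : measurable_fun [set: T] G ->
  m.-integrable E (G \o X) ->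
  nu.-integrable setT (fun x => G x * (q x)%:E)%E /\
  (\int[m]_(w in E) G (X w) = \int[nu]_x (G x * (q x)%:E))%E.
Proof.
move=> mG /integrableP[mGX iGX].
have mEq : measurable_fun setT (EFin \o q) by exact/measurable_EFinP.
split.
  apply/integrableP; split; first exact: emeasurable_funM.
  under eq_integral => x _ do rewrite abseM (@gee0_abs _ (q x)%:E) ?lee_fin//.
  by rewrite -ge0_integral_density//; exact: measurableT_comp.
rewrite integralE [RHS]integralE; congr (_ - _)%E.
- rewrite (@eq_integral _ _ _ _ _ (fun w => G^\+ (X w))%E); last first.
    by move=> w _; rewrite !funeposE.
  rewrite ge0_integral_density//; last exact: measurable_funepos.
  apply: eq_integral => x _.
  by rewrite !funeposE muleC maxe_pMr ?lee_fin// mule0 muleC.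
- rewrite (@eq_integral _ _ _ _ _ (fun w => G^\- (X w))%E); last first.
    by move=> w _; rewrite !funenegE.
  rewrite ge0_integral_density//; last exact: measurable_funeneg.
  apply: eq_integral => x _.
  by rewrite !funenegE muleC maxe_pMr ?lee_fin// mule0 muleN muleC.
Qed.

End density.

(** * Versions of conditional probabilities *)

Section conditional_probability.
Context d d' (U : measurableType d) (T : measurableType d') (R : realType).
Variables (P : probability U R) (Z : U -> T).
Hypothesis mZ : measurable_fun setT Z.
Implicit Types (E F : set U) (g h : T -> R).

Lemma measurable_preimageT (B : set T) : measurable B -> measurable (Z @^-1` B).
Proof. by move=> mB; rewrite -[X in measurable X]setTI; exact: mZ. Qed.

Let measurable_EFin_comp g : measurable_fun setT g ->
  measurable_fun setT (fun w => (g (Z w))%:E).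
Proof. by move=> mg; apply/measurable_EFinP; exact: measurableT_comp. Qed.

(* Splitting on the sign of g, the integral of |g o Z| is a difference of two
   probabilities. *)
Lemma is_cond_prob_integrable E g : measurable E -> is_cond_prob P Z E g ->
  P.-integrable setT (fun w => (g (Z w))%:E).
Proof.
move=> mE [mg gE]; apply/integrableP; split; first exact: measurable_EFin_comp.
pose B := [set x | 0 <= g x].
have mB : measurable B.
  by rewrite -[X in measurable X]setTI; exact: measurable_fun_le.
have mZB := measurable_preimageT mB.
have mZBc := measurable_preimageT (measurableC mB).
rewrite -(setUv (Z @^-1` B)) ge0_integral_setU//; last 2 first.
- rewrite setUv; exact/measurableT_comp/measurable_EFin_comp.
- by apply/disj_setPS => w [].
rewrite (eq_integral (fun w => (g (Z w))%:E)); last first.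
  by move=> w; rewrite inE => Bw; rewrite gee0_abs// lee_fin.
rewrite [X in (_ + X)%E](_ : _ =
    - \int[P]_(w in Z @^-1` (~` B)) (g (Z w))%:E)%E; last first.
  have gB w : (Z @^-1` (~` B)) w -> (0 <= - (g (Z w))%:E)%E.
    by move=> /= /negP; rewrite -ltNge lee_fin oppr_ge0 => /ltW.
  under [X in (- X)%E]eq_integral do rewrite -[(g _)%:E]oppeK.
  rewrite integral_ge0N// oppeK; apply: eq_integral => w; rewrite inE => Bw.
  by rewrite lee0_abs// -oppe_ge0; exact: gB.
rewrite -!gE//; last exact: measurableC.
apply: lte_add_pinfty.
  by rewrite -ge0_fin_numE// fin_num_measure//; exact: measurableI.
have mEZ : measurable (E `&` Z @^-1` (~` B)) by exact: measurableI.
by rewrite -(fineK (fin_num_measure P _ mEZ)) -EFinN ltry.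
Qed.

(** Under the law of [Z], the functions [g] and [h] have the same integral over every measurable
    set. They are integrable by the previous lemma, hence equal almost everywhere, and the
    exceptional set is pulled back along [Z]. *)
Lemma is_cond_prob_unique E g h : measurable E ->
  is_cond_prob P Z E g -> is_cond_prob P Z E h ->
  {ae P, forall w, g (Z w) = h (Z w)}.
Proof.
move=> mE Eg Eh; have [mg gE] := Eg; have [mh hE] := Eh.
have ig := is_cond_prob_integrable mE Eg.
have ih := is_cond_prob_integrable mE Eh.
have mEg : measurable_fun setT (EFin \o g) by exact/measurable_EFinP.
have mEh : measurable_fun setT (EFin \o h) by exact/measurable_EFinP.
pose mixZ := isMeasurableFun.Build _ _ _ _ _ mZ.
pose Z' : {mfun U >-> T} := MeasurableFun.Pack (MeasurableFun.Class mixZ).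
have : ae_eq (distribution P Z') setT (EFin \o g) (EFin \o h).
  apply: integral_ae_eq => //; first exact: integrable_pushforward.
  move=> B _ mB; rewrite !integral_pushforward//; last 2 first.
  - apply: (integrableS measurableT) => //; exact: measurable_preimageT.
  - apply: (integrableS measurableT) => //; exact: measurable_preimageT.
  by rewrite -gE// -hE.
move=> [N [mN N0 subN]]; exists (Z @^-1` N); split => //.
  exact: measurable_preimageT.
move=> w /= gh; apply: subN => /=; apply: contra_not gh => /(_ I)/= gh.
exact: EFin_inj.
Qed.

Lemma ae_is_cond_prob E g h : measurable_fun setT h ->
  {ae P, forall w, g (Z w) = h (Z w)} ->
  is_cond_prob P Z E g -> is_cond_prob P Z E h.
Proof.
move=> mh gh [mg gE]; split=> // B mB; rewrite gE//.
apply: ae_eq_integral => //.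
- exact: measurable_preimageT.
- exact/measurable_funTS/measurable_EFin_comp.
- exact/measurable_funTS/measurable_EFin_comp.
- by apply: filterS gh => w -> _.
Qed.

Lemma is_cond_prob_setU E F g h : measurable E -> measurable F ->
  E `&` F = set0 -> is_cond_prob P Z E g -> is_cond_prob P Z F h ->
  is_cond_prob P Z (E `|` F) (fun z => g z + h z).
Proof.
move=> mE mF EF Eg Fh; have [mg gE] := Eg; have [mh hF] := Fh.
split=> [|B mB]; first exact: measurable_funD.
have mZB := measurable_preimageT mB.
transitivity (P (E `&` Z @^-1` B) + P (F `&` Z @^-1` B))%E.
  rewrite setIUl; apply: measureU; [exact: measurableI|exact: measurableI|].
  by rewrite setIACA EF set0I.
rewrite gE// hF//; under [RHS]eq_integral do rewrite EFinD.
rewrite integralD//.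
- exact: integrableS (is_cond_prob_integrable mE Eg).
- exact: integrableS (is_cond_prob_integrable mF Fh).
Qed.

Lemma is_cond_prob_setC E g : measurable E -> is_cond_prob P Z E g ->
  is_cond_prob P Z (~` E) (fun z => 1 - g z).
Proof.
move=> mE Eg; have [mg gE] := Eg.
split=> [|B mB]; first exact: measurable_funB.
have mZB := measurable_preimageT mB.
under [RHS]eq_integral do rewrite EFinB.
rewrite integralB//.
- rewrite -gE// integral_cst// mul1e setIC -setDE setIC.
  by rewrite measureD// -ge0_fin_numE// fin_num_measure.
- exact: finite_measure_integrable_cst.
- exact: integrableS (is_cond_prob_integrable mE Eg).
Qed.

Section conditional_independence.
Variables (S1 S2 : finType) (V : U -> S1) (W : U -> S2).
Hypotheses (mV : forall u, measurable (V @^-1` [set u]))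
  (mW : forall u, measurable (W @^-1` [set u])).
Hypothesis VW : cond_indep P Z V W.

(** The definition of conditional independence provides some versions; almost sure uniqueness
    carries the product formula over to the versions at hand. *)
Lemma cond_indepM u v g h :
  is_cond_prob P Z (V @^-1` [set u]) g -> is_cond_prob P Z (W @^-1` [set v]) h ->
  is_cond_prob P Z (V @^-1` [set u] `&` W @^-1` [set v]) (fun z => g z * h z).
Proof.
move=> ug vh; have [gu [gv [ugu vgv]]] := VW u v.
apply: ae_is_cond_prob; first by apply: measurable_funM; [case: ug|case: vh].
have := is_cond_prob_unique (mV u) ugu ug.
have := is_cond_prob_unique (mW v) vgv vh.
by apply: filterS2 => w -> ->.
Qed.

(** Ignorability concerns the values of the pair of potential outcomes, whereas an event about one
    potential outcome is a union of two such values. *)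
Lemma cond_indepUM u1 u2 v g h : u1 != u2 ->
  is_cond_prob P Z (V @^-1` [set u1] `|` V @^-1` [set u2]) g ->
  is_cond_prob P Z (W @^-1` [set v]) h ->
  is_cond_prob P Z ((V @^-1` [set u1] `|` V @^-1` [set u2]) `&` W @^-1` [set v])
    (fun z => g z * h z).
Proof.
move=> u12 ug vh.
have [g1 [h1 [ug1 _ _]]] := VW u1 v.
have [g2 [h2 [ug2 _ _]]] := VW u2 v.
have V12 : V @^-1` [set u1] `&` V @^-1` [set u2] = set0.
  by apply/seteqP; split => // w [/= Vu1 Vu2]; move: u12; rewrite -Vu1 -Vu2 eqxx.
have /ae_is_cond_prob : is_cond_prob P Z
    ((V @^-1` [set u1] `|` V @^-1` [set u2]) `&` W @^-1` [set v])
    (fun z => g1 z * h z + g2 z * h z).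
  rewrite setIUl; apply: is_cond_prob_setU;
    [exact: measurableI..| |exact: cond_indepM|exact: cond_indepM].
  by rewrite setIACA V12 set0I.
apply; first by apply: measurable_funM; [case: ug|case: vh].
have := is_cond_prob_unique (measurableU _ _ (mV u1) (mV u2))
  (is_cond_prob_setU (mV u1) (mV u2) V12 ug1 ug2) ug.
by apply: filterS => w <-; rewrite mulrDl.
Qed.

End conditional_independence.

End conditional_probability.

(** * The law of the observations *)

Section observed_law.
Context d d' (U : measurableType d) (T : measurableType d') (R : realType).
Variables (P : probability U R) (nu : {measure set T -> \bar R}).
Variables (Y A : U -> bool) (X : U -> T) (c0 : components T R).
Hypotheses (mY : measurable_fun setT Y) (mA : measurable_fun setT A)
  (mX : measurable_fun setT X).

Definition cell (y a : bool) := Y @^-1` [set y] `&` A @^-1` [set a].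

Lemma measurable_cell y a : measurable (cell y a).
Proof.
by apply: measurableI; rewrite -[X in measurable X]setTI; [exact: mY|exact: mA].
Qed.

Lemma measurable_at_obs d1 (V : measurableType d1) (g : bool -> bool -> T -> V) :
  (forall y a, measurable_fun setT (g y a)) ->
  measurable_fun setT (fun w => g (Y w) (A w) (X w)).
Proof.
move=> mg; rewrite [X in measurable_fun _ X](_ : _ = fun w =>
  if Y w then (if A w then g true true (X w) else g true false (X w))
  else (if A w then g false true (X w) else g false false (X w))); last first.
  by apply/funext => w; case: (Y w); case: (A w).
by do 2?[apply: measurable_fun_ifT => //]; exact: measurableT_comp.
Qed.

Lemma integral_cells (f : U -> \bar R) : measurable_fun setT f ->
  (\int[P]_w f w = \sum_(y : bool) \sum_(a : bool) \int[P]_(w in cell y a) f w)%E.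
Proof.
move=> mf; rewrite !big_bool/=.
rewrite -!integral_setU; try exact: measurable_cell; try exact: measurable_funTS;
  try by (apply: measurableU; exact: measurable_cell).
- congr (integral _ _ _); apply/seteqP; split => // w _ /=; rewrite /cell/=.
  by case: (Y w); case: (A w); tauto.
- by apply/disj_setPS => w; rewrite /cell/=; intuition congruence.
- by apply/disj_setPS => w; rewrite /cell/=; intuition congruence.
- by apply/disj_setPS => w; rewrite /cell/=; intuition congruence.
Qed.

Hypothesis c0_model : in_model nu c0.
Let p := obs_density c0.

Lemma measurable_obs_density (c : components T R) y a : in_model nu c ->
  measurable_fun setT (obs_density c y a).
Proof.
case=> -[mo [mp mc]] _ _ _ _; apply: measurable_funM => //.
case: a; (apply: measurable_funM; first exact: mo) => //.
exact: measurable_funB.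
Qed.

Lemma obs_density_ge0 (c : components T R) y a x : in_model nu c ->
  0 <= obs_density c y a x.
Proof.
case=> _ o01 p01 f0 _; rewrite mulr_ge0//; have /andP[? ?] := p01 x.
have o0 b : 0 <= outd c b y x by have [_] := o01 b x.
by case: a; apply: mulr_ge0 => //; rewrite ?subr_ge0; exact: ltW.
Qed.

Hypothesis obs_law : forall y a (B : set T), measurable B ->
  P (cell y a `&` X @^-1` B) = (\int[nu]_(x in B) (p y a x)%:E)%E.

Let mp y a : measurable_fun setT (p y a) := measurable_obs_density y a c0_model.
Let p0 y a x : 0 <= p y a x := obs_density_ge0 y a x c0_model.

Lemma ge0_integral_at_obs (g : bool -> bool -> T -> R) :
  (forall y a, measurable_fun setT (g y a)) -> (forall y a x, 0 <= g y a x) ->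
  (\int[P]_w (at_obs Y A X g w)%:E =
   \int[nu]_x (\sum_(y : bool) \sum_(a : bool) g y a x * p y a x)%:E)%E.
Proof.
move=> mg g0; rewrite integral_cells; last first.
  by apply/measurable_EFinP; exact: measurable_at_obs.
transitivity (\sum_(y : bool) \sum_(a : bool) \int[nu]_x (g y a x * p y a x)%:E)%E.
  apply: eq_bigr => y _; apply: eq_bigr => a _.
  rewrite (@eq_integral _ _ _ _ _ (fun w => (g y a (X w))%:E)); last first.
    by move=> w; rewrite inE /at_obs => -[/= -> ->].
  rewrite (ge0_integral_density mX (measurable_cell y a) (mp y a)
    (p0 y a) (obs_law y a) (G := fun x => (g y a x)%:E)).
  - by apply: eq_integral => x _.
  - exact/measurable_EFinP.
  - by move=> x; rewrite lee_fin.
have mgp y a : measurable_fun setT (fun x => (g y a x * p y a x)%:E).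
  by apply/measurable_EFinP; exact: measurable_funM.
have gp0 y a x : (0 <= (g y a x * p y a x)%:E)%E by rewrite lee_fin mulr_ge0.
under [RHS]eq_integral do rewrite !big_bool/= !EFinD.
rewrite !big_bool/= !ge0_integralD//;
  try by [exact: emeasurable_funD|move=> x _; rewrite ?adde_ge0].
Qed.

(** The integrability on the covariate side is part of the conclusion because it later justifies
    pulling a constant out of the integral of a derivative. *)
Lemma integral_at_obs (g : bool -> bool -> T -> R) :
  (forall y a, measurable_fun setT (g y a)) ->
  at_obs Y A X g \in Lfun P 1 ->
  nu.-integrable setT
    (fun x => (\sum_(y : bool) \sum_(a : bool) g y a x * p y a x)%:E) /\
  ('E_P[at_obs Y A X g] =
   \int[nu]_x (\sum_(y : bool) \sum_(a : bool) g y a x * p y a x)%:E)%E.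
Proof.
move=> mg /Lfun1_integrable ig.
have H y a : nu.-integrable setT (fun x => (g y a x * p y a x)%:E) /\
    (\int[P]_(w in cell y a) (at_obs Y A X g w)%:E =
     \int[nu]_x (g y a x * p y a x)%:E)%E.
  rewrite (@eq_integral _ _ _ _ _ (fun w => (g y a (X w))%:E)); last first.
    by move=> w; rewrite inE /at_obs => -[/= -> ->].
  apply: (integral_density mX (measurable_cell y a) (mp y a)
    (p0 y a) (obs_law y a) (G := fun x => (g y a x)%:E)).
    exact/measurable_EFinP.
  apply: (@eq_integrable _ _ _ _ _ _ (EFin \o at_obs Y A X g)).
  - exact: measurable_cell.
  - by move=> w; rewrite inE /at_obs => -[/= -> ->].
  - apply: (integrableS measurableT (measurable_cell y a)) => //.
split.
  under eq_fun do rewrite !big_bool/= !EFinD.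
  have I y a := (H y a).1.
  apply: (@integrableD _ _ _ _ _ _ (fun x => (g true true x * p true true x)%:E +
    (g true false x * p true false x)%:E)%E (fun x => (g false true x * p false true x)%:E +
    (g false false x * p false false x)%:E)%E) => //; exact: integrableD.
rewrite unlock integral_cells; last first.
  by apply/measurable_EFinP; exact: measurable_at_obs.
under eq_bigr => y _ do under eq_bigr => a _ do rewrite (H y a).2.
under [RHS]eq_integral do rewrite !big_bool/= !EFinD.
have I y a := (H y a).1.
by rewrite !big_bool/= !integralD//; exact: integrableD.
Qed.

Lemma at_obs_Lfun1 (g : bool -> bool -> T -> R) :
  (forall y a, measurable_fun setT (g y a)) ->
  (\int[nu]_x (\sum_(y : bool) \sum_(a : bool) `|g y a x| * p y a x)%:E < +oo)%E ->
  at_obs Y A X g \in Lfun P 1.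
Proof.
move=> mg goo; apply/Lfun1_integrable/integrableP; split.
  by apply/measurable_EFinP; exact: measurable_at_obs.
rewrite (ge0_integral_at_obs (g := fun y a x => `|g y a x|)) ?goo//.
by move=> y a; exact: measurableT_comp.
Qed.

(** The event that (Y, A) = (y, a) while X lies in the zero set of [p y a] has as probability the
    integral of [p y a] over its own zero set. There are only four such events. *)
Lemma ae_obs_density_neq0 : {ae P, forall w, p (Y w) (A w) (X w) != 0}.
Proof.
have H y a : {ae P, forall w, ~ (cell y a `&` X @^-1` [set x | p y a x == 0]) w}.
  have mB : measurable [set x | p y a x == 0].
    rewrite [X in measurable X](_ : _ = setT `&` p y a @^-1` [set 0]).
      exact: mp.
    by rewrite setTI; apply/seteqP; split => x /= /eqP.
  exists (cell y a `&` X @^-1` [set x | p y a x == 0]); split.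
  - apply: measurableI; first exact: measurable_cell.
    by rewrite -[X in measurable X]setTI; exact: mX.
  - rewrite obs_law//; apply: integral0_eq => x /= /eqP ->//.
  - by move=> w /= /contrapT.
near=> w.
have : ~ (cell (Y w) (A w) `&` X @^-1` [set x | p (Y w) (A w) x == 0]) w.
  have Hw y a : ~ (cell y a `&` X @^-1` [set x | p y a x == 0]) w.
    by case: y; case: a; near: w; exact: H.
  exact: Hw.
by move=> pn0; apply/negP => p00; apply: pn0.
Unshelve. all: by end_near. Qed.

End observed_law.

(** * Directional derivatives *)

Section directional_derivative.
Context (R : realType) (V : normedModType R).
Implicit Types (f g : V -> R) (t v : V).

(** Directional statements around [t] become statements about one real variable on an interval
    around 0, where the one-variable theorems of calculus apply. *)
Lemma near_line t v (Q : V -> Prop) : (\forall s \near t, Q s) ->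
  exists2 eps : R, 0 < eps & forall h : R, h \in `]- eps, eps[ -> Q (h *: v + t).
Proof.
move=> Qt; have cl : (fun h : R => h *: v + t) @ (0 : R) --> t.
  rewrite -[X in _ --> X]add0r -[X in _ --> X + _](scale0r v).
  by apply: cvgD; [apply: cvgZr_tmp; exact: cvg_id|exact: cvg_cst].
have /nbhs_ballP[eps /= eps0 epsQ] := cl _ Qt.
exists eps => // h; rewrite in_itv/= => heps; apply: epsQ.
by rewrite /ball/= sub0r normrN ltr_norml.
Qed.

Lemma difference_quotient_line f t v (h : R) :
  (fun k : R => k^-1 *: (((fun s : R => f (s *: v + t)) \o shift h) (k *: 1)
                         - f (h *: v + t))) =
  (fun k : R => k^-1 *: ((f \o shift (h *: v + t)) (k *: v) - f (h *: v + t))).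
Proof.
apply/funext => k /=; congr (_ *: (f _ - _)).
by rewrite scalerDl addrA /GRing.scale/= mulr1.
Qed.

Lemma derivable_line f t v (h : R) :
  derivable (fun s : R => f (s *: v + t)) h 1 <-> derivable f (h *: v + t) v.
Proof. by rewrite /derivable difference_quotient_line. Qed.

Lemma derive_line f t v (h : R) :
  'D_1 (fun s : R => f (s *: v + t)) h = 'D_v f (h *: v + t).
Proof. by rewrite /derive difference_quotient_line. Qed.

Lemma is_derive_ext f g t v df dg : f =1 g -> df = dg ->
  is_derive t v f df -> is_derive t v g dg.
Proof. by move=> /funext -> ->. Qed.

Lemma is_derive_add f g t v df dg : is_derive t v f df -> is_derive t v g dg ->
  is_derive t v (fun s => f s + g s) (df + dg).
Proof. exact: is_deriveD. Qed.

Lemma is_derive_mul f g t v df dg : is_derive t v f df -> is_derive t v g dg ->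
  is_derive t v (fun s => f s * g s) (df * g t + f t * dg).
Proof.
move=> Df Dg; apply: is_derive_ext (is_deriveM Df Dg) => //.
by rewrite addrC [g t *: _]mulrC.
Qed.

Lemma is_derive_inv f t v df : f t != 0 -> is_derive t v f df ->
  is_derive t v (fun s => (f s)^-1) (- df / f t ^+ 2).
Proof.
move=> ft [Df <-]; apply: DeriveDef; first exact: derivableV.
by rewrite deriveV// [LHS]mulNr mulNr mulrC.
Qed.

Lemma is_derive_const (c : R) t v : is_derive t v (fun=> c) 0.
Proof. exact: is_derive_cst. Qed.

Lemma is_derive_scale (c : R) f t v df : is_derive t v f df ->
  is_derive t v (fun s => c * f s) (c * df).
Proof.
move=> Df; apply: is_derive_ext (is_derive_mul (is_derive_const c t v) Df) => //.
by rewrite mul0r add0r.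
Qed.

(** Along the line through [t] with direction [v], the point 0 is an interior minimum. *)
Lemma derive_ge0_eq0 f t v : (\forall s \near t, 0 <= f s /\ derivable f s v) ->
  f t = 0 -> 'D_v f t = 0.
Proof.
move=> /near_line - /(_ v)[eps eps0 fge0] ft0.
have [_] : is_derive (0 : R) 1 (fun h : R => f (h *: v + t)) 0.
  apply: (@derive1_at_min R _ (- eps) eps).
  - by rewrite ge0_cp ?ltW.
  - by move=> h /fge0[_]; exact: (derivable_line f t v h).2.
  - by rewrite in_itv/= oppr_lt0 eps0.
  - by move=> h /fge0[+ _]; rewrite scale0r add0r ft0.
by rewrite derive_line scale0r add0r.
Qed.

End directional_derivative.

(** * Differentiation under the integral sign in a direction *)

Section differentiation_under_the_integral.
Context d (T : measurableType d) (R : realType) (V : normedModType R).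
Variables (nu : {measure set T -> \bar R}) (K : V -> T -> R) (t v : V).

Lemma measurable_derive : (\forall s \near t, measurable_fun setT (K s)) ->
  (forall x, derivable (K ^~ x) t v) ->
  measurable_fun setT (fun x => 'D_v (K ^~ x) t).
Proof.
move=> /near_line - /(_ v)[eps eps0 mK] dK.
(* These increments are nonzero, tend to 0 and stay inside the interval where [K] is measurable in
   x; the derivative is then a pointwise limit of measurable difference quotients. *)
pose h n : R := eps / 2 * harmonic n.
have h0 n : h n != 0 by rewrite mulf_neq0// ?gt_eqF ?divr_gt0 ?harmonic_gt0.
have heps n : h n \in `]- eps, eps[.
  have hn0 : 0 < h n by rewrite mulr_gt0 ?divr_gt0 ?harmonic_gt0.
  rewrite in_itv/= (lt_trans _ hn0) ?oppr_lt0//=.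
  have : h n <= eps / 2.
    by rewrite ger_pMr ?divr_gt0//= invf_le1// ler1n.
  by move/le_lt_trans; apply; rewrite ltr_pdivrMr// ltr_pMr// ltr1n.
have h_cvg : h n @[n --> \oo] --> (0 : R).
  by rewrite -(mulr0 (eps / 2)); apply: cvgMl_tmp; exact: cvg_harmonic.
apply/measurable_EFinP.
apply: (@emeasurable_fun_cvg _ _ _ _
    (fun n x => ((h n)^-1 * (K (h n *: v + t) x - K t x))%:E)).
  move=> n; apply/measurable_EFinP.
  apply: measurable_funM => //; apply: measurable_funB; first exact: mK.
  by rewrite -[t]add0r -(scale0r v); apply: mK; rewrite in_itv/= oppr_lt0 eps0.
move=> x _; apply: cvg_EFin; first exact: nearW.
have /cvgr_dnbhsP := dK x; apply; split => //.
Qed.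

Variable G : T -> R.
Hypothesis iG : nu.-integrable setT (EFin \o G).
Hypothesis nearK : \forall s \near t, nu.-integrable setT (EFin \o K s) /\
  forall x, derivable (K ^~ x) s v /\ `|'D_v (K ^~ x) s| <= G x.

(** Only the restriction to the line matters, so this is the dominated one-variable theorem on []-
    eps, eps[], read back at the point 0. *)
Lemma is_derive_integral :
  is_derive t v (fun s => \int[nu]_x K s x) (\int[nu]_x 'D_v (K ^~ x) t).
Proof.
have [eps eps0 Keps] := near_line v nearK.
have e0 : 0 \in `]- eps, eps[ by rewrite in_itv/= oppr_lt0 eps0.
have D h x : partial1of2 (fun s y => K (s *: v + t) y) h x =
    'D_v (K ^~ x) (h *: v + t).
  by rewrite partial1of2E (derive_line (K ^~ x)).
have G0 x : 0 <= G x.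
  by have [_ /(_ x)[_]] := Keps _ e0; apply: le_trans; exact: normr_ge0.
have iK (h : R) : `]- eps, eps[%classic h ->
    nu.-integrable setT (EFin \o (fun x => K (h *: v + t) x)).
  by move=> /Keps[].
have dK (h : R) x : `]- eps, eps[%classic h -> setT x ->
    derivable ((fun s y => K (s *: v + t) y) ^~ x) h 1.
  by move=> /Keps[_ /(_ x)[+ _]] _; exact: (derivable_line (K ^~ x) t v h).2.
have GK (h : R) x : `]- eps, eps[%classic h -> setT x ->
    `|partial1of2 (fun s y => K (s *: v + t) y) h x| <= G x.
  by move=> /Keps[_ /(_ x)[_ +]] _; rewrite D.
have dF := derivable_under_integral measurableT e0 iK dK G0 iG GK.
have FE := differentiation_under_integral measurableT e0 iK dK G0 iG GK.
split.
  by move/(derivable_line (fun s => \int[nu]_x K s x) t v 0).1 : dF;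
    rewrite scale0r add0r.
rewrite -[t in LHS]add0r -(scale0r v).
rewrite -(derive_line (fun s => \int[nu]_x K s x)) -derive1E.
by rewrite FE; apply: eq_Rintegral => x _; rewrite D scale0r add0r.
Qed.

End differentiation_under_the_integral.

(** * The identification formulas along a submodel *)

Section pathwise_derivative.
Context d d' (U : measurableType d) (T : measurableType d') (R : realType).
Variables (P : probability U R) (nu : {measure set T -> \bar R}).
Variables (Y A : U -> bool) (X : U -> T) (c0 : components T R).

Definition bilin (k0 k1 k2 k3 : R) (c : components T R) (x : T) : R :=
  k0 + k1 * outd c true true x + k2 * outd c false true x
  + k3 * (outd c true true x * outd c false true x).

(** The weight (1 - e) f is the density of X on the event A = 0, the group on which the causal
    quantity is evaluated. *)
Definition untreated (k0 k1 k2 k3 : R) (c : components T R) (x : T) : R :=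
  bilin k0 k1 k2 k3 c x * (1 - prop c x) * covd c x.

Lemma measurable_bilin k0 k1 k2 k3 (c : components T R) : in_model nu c ->
  measurable_fun setT (bilin k0 k1 k2 k3 c).
Proof.
case=> -[mo _] _ _ _ _.
have := mo true true; have := mo false true => mw mu.
do 2![apply: measurable_funD; [|by do ?apply: measurable_funM]].
by apply: measurable_funD => //; exact: measurable_funM.
Qed.

Lemma outd_le1 (c : components T R) a y x : in_model nu c -> outd c a y x <= 1.
Proof.
case=> _ /(_ a x)[<- o0] _ _ _.
by case: y; rewrite ?lerDl ?lerDr.
Qed.

Lemma outd_ge0 (c : components T R) a y x : in_model nu c -> 0 <= outd c a y x.
Proof. by case=> _ /(_ a x)[_]; exact. Qed.

Lemma normM_le (a b a' b' : R) : `|a| <= a' -> `|b| <= b' -> `|a * b| <= a' * b'.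
Proof. by move=> aa bb; rewrite normrM ler_pM. Qed.

Lemma bilin_bound k0 k1 k2 k3 (c : components T R) x : in_model nu c ->
  `|bilin k0 k1 k2 k3 c x| <= `|k0| + `|k1| + `|k2| + `|k3|.
Proof.
move=> mc; have o1 a : `|outd c a true x| <= 1.
  by rewrite ger0_norm ?(outd_le1 _ _ _ mc)// (outd_ge0 _ _ _ mc).
do 3![apply: (le_trans (ler_normD _ _)); apply: lerD => //; last first;
  first by rewrite normrM ler_piMr// ?normrM ?mulr_ile1].
Qed.

Lemma in_model_integrable (c : components T R) (h : T -> R) (C : R) :
  in_model nu c -> measurable_fun setT h -> (forall x, `|h x| <= C) ->
  nu.-integrable setT (fun x => (h x * covd c x)%:E).
Proof.
move=> [[_ [_ mc]] _ _ c_ge0 c1] mh hC.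
apply: (@le_integrable _ _ _ _ _ measurableT _ (fun x => C%:E * (covd c x)%:E)%E) => //.
- by apply/measurable_EFinP; exact: measurable_funM.
- move=> x _; rewrite -EFinM !abse_EFin lee_fin !normrM ler_wpM2r//.
  exact: le_trans (hC x) (ler_norm _).
- apply: integrableZl => //; apply/integrableP; split; first exact/measurable_EFinP.
  under eq_integral => x _ do rewrite abse_EFin ger0_norm//.
  by rewrite c1 ltry.
Qed.

Lemma untreated_integrable k0 k1 k2 k3 (c : components T R) : in_model nu c ->
  nu.-integrable setT (EFin \o untreated k0 k1 k2 k3 c).
Proof.
move=> mc; apply: (in_model_integrable (C := `|k0| + `|k1| + `|k2| + `|k3|)) => //.
  apply: measurable_funM; first exact: measurable_bilin.
  by apply: measurable_funB => //; case: mc => -[_ []].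
move=> x; rewrite -[leRHS]mulr1; apply: normM_le; first exact: bilin_bound.
case: mc => _ _ /(_ x)/andP[p0 p1] _ _.
by rewrite ger0_norm ?subr_ge0; [rewrite lerBlDr lerDl|]; exact: ltW.
Qed.

(** The scalar [r] covers all uses: [r = -1] for differences, and [r] equal to plus or minus the
    value of gamma for combining numerator and denominator. *)
Lemma integral_untreatedD k0 k1 k2 k3 l0 l1 l2 l3 (r : R) (c : components T R) :
  in_model nu c ->
  \int[nu]_x untreated (k0 + r * l0) (k1 + r * l1) (k2 + r * l2) (k3 + r * l3) c x
  = \int[nu]_x untreated k0 k1 k2 k3 c x + r * \int[nu]_x untreated l0 l1 l2 l3 c x.
Proof.
move=> mc; have ik := untreated_integrable k0 k1 k2 k3 mc.
have il := untreated_integrable l0 l1 l2 l3 mc.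
rewrite -RintegralZl// -RintegralD//.
  by apply: eq_Rintegral => x _; rewrite /untreated /bilin; ring.
apply: (@integrableZl _ _ _ _ _ measurableT r (EFin \o untreated l0 l1 l2 l3 c)) => //.
Qed.

(* Up to the factor 1 - e, numerator and denominator of both identification
   formulas are bilinear in the regressions: (c1, c2) = (1, 0) gives gamma_mono
   and (c1, c2) = (0, 1) gives gamma_indep. *)
Definition gamma_coef (c1 c2 : R) (c : components T R) : R :=
  \int[nu]_x untreated 0 1 (- c1) (- c2) c x / \int[nu]_x untreated 1 0 (- 1) 0 c x.

(** Splitting the integral of a difference needs integrability, hence the restriction to components
    in the model. This is enough for derivatives, as a regular submodel stays in the model near the
    truth. *)
Lemma gamma_monoE (c : components T R) : in_model nu c ->
  gamma_mono nu c = gamma_coef 1 0 c.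
Proof.
move=> mc; rewrite /gamma_mono /gamma_coef /model_mean; congr (_ / _); last first.
  by apply: eq_Rintegral => x _; rewrite /untreated /bilin; ring.
transitivity (\int[nu]_x untreated 0 1 0 0 c x
  + (- 1) * \int[nu]_x untreated 0 0 1 0 c x); last first.
  rewrite -integral_untreatedD//.
  by apply: eq_Rintegral => x _; rewrite /untreated /bilin; ring.
by rewrite mulN1r; congr (_ - _); apply: eq_Rintegral => x _;
  rewrite /untreated /bilin; ring.
Qed.

Lemma gamma_indepE (c : components T R) : in_model nu c ->
  gamma_indep nu c = gamma_coef 0 1 c.
Proof.
move=> mc; rewrite /gamma_indep /gamma_coef /model_mean; congr (_ / _); last first.
  by apply: eq_Rintegral => x _; rewrite /untreated /bilin; ring.
transitivity (\int[nu]_x untreated 0 1 0 0 c x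
  + (- 1) * \int[nu]_x untreated 0 0 0 1 c x); last first.
  rewrite -integral_untreatedD//.
  by apply: eq_Rintegral => x _; rewrite /untreated /bilin; ring.
by rewrite mulN1r; congr (_ - _); apply: eq_Rintegral => x _;
  rewrite /untreated /bilin; ring.
Qed.

Context (k : nat) (M : 'rV[R]_k -> components T R) (t0 : 'rV[R]_k) (j : 'I_k).
Hypothesis regM : regular_submodel P nu Y A X c0 M t0.
Let v : 'rV[R]_k := delta_mx 0 j.

Lemma is_derive_untreated_at k0 k1 k2 k3 t x du dw de df :
  is_derive t v (fun s => outd (M s) true true x) du ->
  is_derive t v (fun s => outd (M s) false true x) dw ->
  is_derive t v (fun s => prop (M s) x) de ->
  is_derive t v (fun s => covd (M s) x) df ->
  is_derive t v (fun s => untreated k0 k1 k2 k3 (M s) x)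
    ((k1 * du + k2 * dw + k3 * (du * outd (M t) false true x
                                + outd (M t) true true x * dw))
      * (1 - prop (M t) x) * covd (M t) x
     + bilin k0 k1 k2 k3 (M t) x
       * ((1 - prop (M t) x) * df - de * covd (M t) x)).
Proof.
move=> Du Dw De Df.
have D1 := is_derive_add (is_derive_const k0 t v) (is_derive_scale k1 Du).
have D2 := is_derive_add D1 (is_derive_scale k2 Dw).
have D3 := is_derive_add D2 (is_derive_scale k3 (is_derive_mul Du Dw)).
have D4 := is_derive_add (is_derive_const 1 t v) (is_derive_scale (-1) De).
apply: is_derive_ext (is_derive_mul (is_derive_mul D3 D4) Df) => [s|].
  by rewrite /untreated /bilin; ring.
by rewrite /bilin; ring.
Qed.

Lemma is_derive_untreated k0 k1 k2 k3 :
  is_derive t0 v (fun t => \int[nu]_x untreated k0 k1 k2 k3 (M t) x)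
    (\int[nu]_x partial j (fun t => untreated k0 k1 k2 k3 (M t) x) t0).
Proof.
case: regM => _ _ [G [iG nearM]].
(* Each derivative times the density is at most [G], and the regressions and 1 - e are at most 1.
   The term in [k3] counts twice by the product rule, and the factor 2 bounds the derivative of (1 -
   e) f. *)
pose C := `|k1| + `|k2| + `|k3| + `|k3| + (`|k0| + `|k1| + `|k2| + `|k3|) * 2.
apply: (@is_derive_integral _ _ _ _ _ _ _ _ (fun x => C * G x)).
  exact: (@integrableZl _ _ _ _ _ measurableT C (EFin \o G)).
near=> t; have [mt bt] : in_model nu (M t) /\
    forall (j : 'I_k) (x : T),
    [/\ forall a y, derivable (fun t' => outd (M t') a y x) t (delta_mx 0 j) /\
           `|partial j (fun t' => outd (M t') a y x) t| * covd (M t) x <= G x,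
        derivable (fun t' => prop (M t') x) t (delta_mx 0 j) /\
            `|partial j (fun t' => prop (M t') x) t| * covd (M t) x <= G x &
        derivable (fun t' => covd (M t') x) t (delta_mx 0 j) /\
          `|partial j (fun t' => covd (M t') x) t| <= G x].
  by near: t.
split=> [|x]; first exact: untreated_integrable.
have [bo [dp bp] [dc bc]] := bt j x.
have [du bu] := bo true true; have [dw bw] := bo false true.
have [Dt ->] := is_derive_untreated_at k0 k1 k2 k3 (derivableP du) (derivableP dw)
  (derivableP dp) (derivableP dc).
split=> //; move: bu bw bp bc; rewrite /partial -/v.
set u' := 'D_v _ t; set w' := 'D_v _ t; set p' := 'D_v _ t; set c' := 'D_v _ t.
have f0 : 0 <= covd (M t) x by case: mt.
have o1 a : `|outd (M t) a true x| <= 1.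
  by rewrite ger0_norm ?(outd_le1 _ _ _ mt)// (outd_ge0 _ _ _ mt).
have e1 : `|1 - prop (M t) x| <= 1.
  case: mt => _ _ /(_ x)/andP[p0 p1] _ _.
  by rewrite ger0_norm ?subr_ge0; [rewrite lerBlDr lerDl|]; exact: ltW.
move=> bu bw bp bc.
have nf (a : R) : `|a| * covd (M t) x = `|a * covd (M t) x|.
  by rewrite normrM (ger0_norm f0).
rewrite !nf in bp bu bw.
have eoG (a b : R) : `|a| <= 1 -> `|b| <= G x -> `|a * b| <= G x.
  by move=> a1 bG; rewrite -[leRHS]mul1r; exact: normM_le.
(* Regularity bounds the derivatives only after multiplication by the covariate density, so each of
   them is first brought next to that density. *)
have -> : (k1 * u' + k2 * w' + k3 * (u' * outd (M t) false true x
      + outd (M t) true true x * w')) * (1 - prop (M t) x) * covd (M t) x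
    + bilin k0 k1 k2 k3 (M t) x
      * ((1 - prop (M t) x) * c' - p' * covd (M t) x) =
  k1 * ((1 - prop (M t) x) * (u' * covd (M t) x))
  + k2 * ((1 - prop (M t) x) * (w' * covd (M t) x))
  + k3 * ((1 - prop (M t) x) * (outd (M t) false true x * (u' * covd (M t) x)))
  + k3 * ((1 - prop (M t) x) * (outd (M t) true true x * (w' * covd (M t) x)))
  + bilin k0 k1 k2 k3 (M t) x
      * ((1 - prop (M t) x) * c' - p' * covd (M t) x) by ring.
have -> : C * G x = `|k1| * G x + `|k2| * G x + `|k3| * G x + `|k3| * G x
    + (`|k0| + `|k1| + `|k2| + `|k3|) * (G x + G x) by rewrite /C; ring.
apply: (le_trans (ler_normD _ _)); apply: lerD; last first.
  apply: normM_le; first exact: bilin_bound.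
  by apply: (le_trans (ler_normB _ _)); apply: lerD => //; exact: eoG.
apply: (le_trans (ler_normD _ _)); apply: lerD; last first.
  by apply: normM_le => //; apply: (eoG) => //; exact: eoG.
apply: (le_trans (ler_normD _ _)); apply: lerD; last first.
  by apply: normM_le => //; apply: (eoG) => //; exact: eoG.
apply: (le_trans (ler_normD _ _)); apply: lerD; last first.
  by apply: normM_le => //; exact: eoG.
by apply: normM_le => //; exact: eoG.
Unshelve. all: by end_near. Qed.

(** The coefficients on the right are those of the numerator minus [g] times the denominator: (0, 1,
    -c1, -c2) - g (1, 0, -1, 0). *)
Lemma is_derive_gamma_coef c1 c2 (g := gamma_coef c1 c2 c0)
    (D := \int[nu]_x untreated 1 0 (- 1) 0 c0 x) : D != 0 ->
  is_derive t0 v (fun t => gamma_coef c1 c2 (M t))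
    (D^-1 * \int[nu]_x
       partial j (fun t => untreated (- g) 1 (g - c1) (- c2) (M t) x) t0).
Proof.
move=> D0; case: (regM) => M0 _ [G [iG nearM]].
have mM : \forall t \near t0, in_model nu (M t) by apply: filterS nearM => t [].
set I := fun t => \int[nu]_x untreated (- g) 1 (g - c1) (- c2) (M t) x.
set Dn := fun t => \int[nu]_x untreated 1 0 (- 1) 0 (M t) x.
(* The numerator is I + g Dn with I t0 = 0, so the quotient has derivative I' / Dn. *)
have dI : is_derive t0 v I _ := is_derive_untreated (- g) 1 (g - c1) (- c2).
have dD : is_derive t0 v Dn _ := is_derive_untreated 1 0 (- 1) 0.
have DnD : Dn t0 = D by rewrite /Dn M0.
have NE t : in_model nu (M t) ->
    \int[nu]_x untreated 0 1 (- c1) (- c2) (M t) x = I t + g * Dn t.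
  move=> mt; rewrite -integral_untreatedD//.
  by apply: eq_Rintegral => x _; rewrite /untreated /bilin; ring.
have I0 : I t0 = 0.
  have := NE t0 (nbhs_singleton mM); rewrite DnD M0 /g /gamma_coef -/D => E.
  by apply: (addIr (g * D)); rewrite -E add0r divfK.
apply: (@near_eq_is_derive _ _ _ (fun t => (I t + g * Dn t) * (Dn t)^-1)).
  by apply: filterS mM => t mt; rewrite /gamma_coef -NE.
apply: is_derive_ext (is_derive_mul (is_derive_add dI (is_derive_scale g dD))
  (is_derive_inv _ dD)) => //; last by rewrite DnD.
by rewrite I0 DnD -[in RHS](mulr1 (D^-1)); field.
Qed.

End pathwise_derivative.

(** * Scores *)

Section bounded.
Context d (U : measurableType d) (R : realType) (P : probability U R).

Lemma bounded_Lfun2 (h : U -> R) (C : R) : measurable_fun setT h ->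
  (forall w, `|h w| <= C) -> h \in Lfun P 2%:E.
Proof.
move=> mh hC; rewrite inE; apply/andP; split; rewrite inE//=.
rewrite /finite_norm unlock/=; apply: poweR_lty.
apply: (@le_lt_trans _ _ (\int[P]_w (C ^+ 2)%:E)%E); last first.
  by rewrite integral_cst//= probability_setT mule1 ltry.
apply: ge0_le_integral => //.
- apply/measurable_EFinP; apply: (measurableT_comp (measurable_powR _)) => //.
  exact: measurableT_comp.
- move=> w _; rewrite lee_fin powR_mulrn// lerXn2r ?nnegrE//.
  exact: le_trans (hC w).
Qed.

Lemma bounded_Lfun1 (h : U -> R) (C : R) : measurable_fun setT h ->
  (forall w, `|h w| <= C) -> h \in Lfun P 1.
Proof.
move=> mh hC; apply: Lfun_subset12; first exact: fin_num_measure.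
exact: bounded_Lfun2 mh hC.
Qed.

(** The power with exponent -1 is measurable and agrees with the inverse on nonnegative numbers.
    This includes 0, where both are 0, so the lemma applies to densities that vanish somewhere. *)
Lemma measurable_ge0_inv d' (T : measurableType d') (f : T -> R) :
  measurable_fun setT f -> (forall x, 0 <= f x) ->
  measurable_fun setT (fun x => (f x)^-1).
Proof.
move=> mf f0; rewrite (_ : (fun x => _) = fun x => f x `^ (-1)).
  exact: (measurableT_comp (measurable_powR _)).
by apply/funext => x; rewrite powR_inv1.
Qed.

Lemma ae_Lfun1 (f g : U -> R) : measurable_fun setT g ->
  {ae P, forall w, f w = g w} -> f \in Lfun P 1 -> g \in Lfun P 1.
Proof.
move=> mg fg /Lfun1_integrable/integrableP[mf foo]; apply/Lfun1_integrable/integrableP.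
split; first exact/measurable_EFinP.
rewrite (@ae_eq_integral _ _ _ P setT (fun w => `|(f w)%:E|%E))//.
- by apply: measurableT_comp => //; exact/measurable_EFinP.
- exact: measurableT_comp.
- by apply: filterS fg => w -> _.
Qed.

Lemma ae_expectation (f g : U -> R) : measurable_fun setT f ->
  measurable_fun setT g -> {ae P, forall w, f w = g w} -> ('E_P[f] = 'E_P[g])%E.
Proof.
move=> mf mg fg; rewrite unlock; apply: ae_eq_integral => //.
- exact/measurable_EFinP.
- exact/measurable_EFinP.
- by apply: filterS fg => w -> _.
Qed.

End bounded.

Section score.
Context d d' (U : measurableType d) (T : measurableType d') (R : realType).
Variables (P : probability U R) (nu : {measure set T -> \bar R}).
Variables (Y A : U -> bool) (X : U -> T) (c0 : components T R).
Context (k : nat) (M : 'rV[R]_k -> components T R) (t0 : 'rV[R]_k) (j : 'I_k).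
Hypothesis regM : regular_submodel P nu Y A X c0 M t0.
Let v : 'rV[R]_k := delta_mx 0 j.

Let nearM : \forall t \near t0, in_model nu (M t) /\
  forall x, [/\ forall a y, derivable (fun t' => outd (M t') a y x) t v,
    derivable (fun t' => prop (M t') x) t v &
    derivable (fun t' => covd (M t') x) t v].
Proof.
case: regM => _ _ [G [_ nM]]; apply: filterS nM => t [mt bt]; split => // x.
by have [bo [bp _] [bf _]] := bt j x; split => // a y; have [] := bo a y.
Qed.

Definition partial_obs_density t y a x : R :=
  let do_ := partial j (fun t' => outd (M t') a y x) t in
  let de := partial j (fun t' => prop (M t') x) t in
  let df := partial j (fun t' => covd (M t') x) t in
  let o := outd (M t) a y x in
  let e := prop (M t) x in
  let f := covd (M t) x in
  if a then (do_ * e + o * de) * f + o * e * df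
  else (do_ * (1 - e) - o * de) * f + o * (1 - e) * df.

(** The derivative is needed in a neighbourhood of [t0] and not just at [t0], since the minimum
    argument for zeros of the density asks for derivability along a whole segment. *)
Lemma near_is_derive_obs_density : \forall t \near t0, forall y a x,
  is_derive t v (fun t' => obs_density (M t') y a x) (partial_obs_density t y a x).
Proof.
apply: filterS nearM => t [_ dt] y a x; have [/(_ a y)/derivableP do_] := dt x.
move=> /derivableP de /derivableP df; rewrite /partial_obs_density.
have de1 := is_derive_add (is_derive_const 1 t v) (is_derive_scale (-1) de).
case: a do_ => do_.
  by apply: is_derive_ext (is_derive_mul (is_derive_mul do_ de) df) => [s|].
apply: is_derive_ext (is_derive_mul (is_derive_mul do_ de1) df) => [s|].
  by rewrite /obs_density mulN1r.
by rewrite /partial; ring.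
Qed.

(* A zero of the density is a minimum of it along the submodel, so both sides
   vanish there, the score being x / 0 = 0. *)
Lemma score_density y a x : score M t0 j y a x * obs_density c0 y a x =
  partial j (fun t' => obs_density (M t') y a x) t0.
Proof.
have M0 : M t0 = c0 by case: regM.
rewrite /score M0; have [p0|p0] := eqVneq (obs_density c0 y a x) 0; last first.
  by rewrite divfK.
rewrite p0 mulr0; apply/esym/derive_ge0_eq0; last by rewrite M0.
near=> t; split.
  apply: (@obs_density_ge0 _ _ _ nu).
  by near: t; apply: filterS nearM => t [].
suff [] : is_derive t v (fun t' => obs_density (M t') y a x) (partial_obs_density t y a x) by [].
by near: t; apply: filterS near_is_derive_obs_density => t /(_ y a x).
Unshelve. all: by end_near. Qed.

(** The two outcome probabilities sum to 1 throughout a neighbourhood of [t0]. *)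
Lemma partial_outd_false a x : partial j (fun t' => outd (M t') a false x) t0
  = - partial j (fun t' => outd (M t') a true x) t0.
Proof.
have [_ /(_ x)[/(_ a true)/derivableP do_ _ _]] := nbhs_singleton nearM.
have dn := is_derive_add (is_derive_const 1 t0 v) (is_derive_scale (-1) do_).
have [_] : is_derive t0 v (fun t' => outd (M t') a false x)
    (0 + -1 * 'D_v (fun t' => outd (M t') a true x) t0).
  apply: near_eq_is_derive dn; apply: filterS nearM => t [[_ /(_ a x)[+ _] _ _ _] _].
  by move=> TF; rewrite mulN1r -TF addrC addKr.
by rewrite /partial -/v => ->; ring.
Qed.

(** The numerator is a limit of difference quotients of densities that are measurable near [t0]. *)
Lemma measurable_score y a : measurable_fun setT (score M t0 j y a).
Proof.
have m0 : in_model nu (M t0) by have [] := nbhs_singleton nearM.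
apply: measurable_funM; last first.
  apply: measurable_ge0_inv; first exact: (@measurable_obs_density _ _ _ nu).
  by move=> x; exact: (@obs_density_ge0 _ _ _ nu).
apply: measurable_derive.
  by apply: filterS nearM => t [mt _]; exact: (@measurable_obs_density _ _ _ nu).
move=> x; have /(_ y a x)[] := nbhs_singleton near_is_derive_obs_density.
by [].
Qed.

End score.

(** * The gradient in the tangent space *)

Section canonical_gradient.
Context d d' (U : measurableType d) (T : measurableType d') (R : realType).
Variables (P : probability U R) (nu : {measure set T -> \bar R}).
Variables (Y A : U -> bool) (X : U -> T) (c0 : components T R).
Hypotheses (mY : measurable_fun setT Y) (mA : measurable_fun setT A)
  (mX : measurable_fun setT X).
Hypothesis c0_model : in_model nu c0.
Hypothesis obs_law : forall y a (B : set T), measurable B ->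
  P (cell Y A y a `&` X @^-1` B) = (\int[nu]_(x in B) (obs_density c0 y a x)%:E)%E.
Variables (c1 c2 : R).
Let D := \int[nu]_x untreated 1 0 (- 1) 0 c0 x.
Hypothesis D0 : D != 0.
Let g := gamma_coef nu c1 c2 c0.

Let u := outd c0 true true.
Let w := outd c0 false true.
Let e := prop c0.
Let kappa := bilin (- g) 1 (g - c1) (- c2) c0.

(* The three coefficients are the factors of the derivatives of f_1, of f_0 and
   of (1 - e) f in the derivative of untreated, divided by D. *)
Definition gradient (y a : bool) (x : T) : R :=
  a%:R * ((1 - e x) / e x * ((1 - c2 * w x) / D) * (y%:R - u x))
  + (1 - a%:R) * ((g - c1 - c2 * u x) / D * (y%:R - w x))
  - kappa x / D * (a%:R - 1).

Let e01 x : 0 < e x < 1. Proof. by case: c0_model => _ _ /(_ x). Qed.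

Let e_neq0 x : e x != 0. Proof. by have /andP[/gt_eqF ->] := e01 x. Qed.

Let m_u : measurable_fun setT u. Proof. by case: c0_model => -[+ _] _ _ _ _; exact. Qed.
Let m_w : measurable_fun setT w. Proof. by case: c0_model => -[+ _] _ _ _ _; exact. Qed.
Let m_e : measurable_fun setT e. Proof. by case: c0_model => -[_ []]. Qed.
Let m_kappa : measurable_fun setT kappa.
Proof. exact: (measurable_bilin _ _ _ _ c0_model). Qed.

Let outd_false a x : outd c0 a false x = 1 - outd c0 a true x.
Proof. by case: c0_model => _ /(_ a x)[<- _] _ _ _; rewrite addrAC subrr add0r. Qed.

Let me1 : measurable_fun setT (fun x => (1 - e x) / e x).
Proof.
apply: measurable_funM; first exact: measurable_funB.
by apply: measurable_ge0_inv => // x; have /andP[/ltW] := e01 x.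
Qed.

Lemma measurable_gradient y a : measurable_fun setT (gradient y a).
Proof.
apply: measurable_funB; last by do ?apply: measurable_funM.
apply: measurable_funD.
  apply: measurable_funM => //; apply: measurable_funM; last exact: measurable_funB.
  apply: measurable_funM => //; apply: measurable_funM => //.
  by apply: measurable_funB => //; exact: measurable_funM.
apply: measurable_funM => //; apply: measurable_funM; last exact: measurable_funB.
apply: measurable_funM => //; apply: measurable_funB => //; exact: measurable_funM.
Qed.

Lemma gradient_score (k : nat) (M : 'rV[R]_k -> components T R) (t0 : 'rV[R]_k)
    (j : 'I_k) x : regular_submodel P nu Y A X c0 M t0 ->
  \sum_(y : bool) \sum_(a : bool)
    gradient y a x * score M t0 j y a x * obs_density c0 y a x
  = D^-1 * partial j (fun t => untreated (- g) 1 (g - c1) (- c2) (M t) x) t0.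
Proof.
move=> regM; have M0 : M t0 = c0 by case: regM.
have [_ _ [G [_ nM]]] := regM.
have [_ /(_ j x)[bo [/derivableP de _] [/derivableP df _]]] := nbhs_singleton nM.
have [/derivableP du _] := bo true true; have [/derivableP dw _] := bo false true.
rewrite [in RHS]/partial.
have [_ ->] := is_derive_untreated_at (- g) 1 (g - c1) (- c2) du dw de df.
(* This replaces score times density by the derivative of the density, so no division by the density
   remains and its zeros need no separate case. *)
have SD y a : gradient y a x * score M t0 j y a x * obs_density c0 y a x =
    gradient y a x * partial_obs_density M j t0 y a x.
  rewrite -mulrA; congr (_ * _); rewrite (score_density j regM).
  by have /(_ y a x)[] := nbhs_singleton (near_is_derive_obs_density j regM).
(* Eliminating the outcome [false] leaves four free derivatives, and a rational identity in which
   only [e x] and [D] are inverted. *)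
rewrite !big_bool !SD /partial_obs_density !(partial_outd_false j regM) M0 /partial.
rewrite /gradient !outd_false /kappa /bilin -/(u x) -/(w x) -/(e x).
rewrite /=.
set U' := 'D_ _ (fun s => outd (M s) true true x) t0.
set W' := 'D_ _ (fun s => outd (M s) false true x) t0.
set E' := 'D_ _ (fun s => prop (M s) x) t0.
set F' := 'D_ _ (fun s => covd (M s) x) t0.
by field; rewrite D0 e_neq0.
Qed.

(** The integrand is that of the numerator minus [g] times the denominator, and [g] is their ratio
    at the truth. *)
Lemma integral_untreated0 : \int[nu]_x untreated (- g) 1 (g - c1) (- c2) c0 x = 0.
Proof.
rewrite (_ : \int[nu]_x _ = \int[nu]_x untreated 0 1 (- c1) (- c2) c0 x + (- g) * D).
  by rewrite /g /gamma_coef -/D mulNr divfK// subrr.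
rewrite -integral_untreatedD//.
by apply: eq_Rintegral => x _; rewrite /untreated /bilin; ring.
Qed.

Let bw x : `|w x| <= 1.
Proof. by rewrite ger0_norm ?(outd_le1 _ _ _ c0_model) ?(outd_ge0 _ _ _ c0_model). Qed.
Let bu x : `|u x| <= 1.
Proof. by rewrite ger0_norm ?(outd_le1 _ _ _ c0_model) ?(outd_ge0 _ _ _ c0_model). Qed.

(** [Br], [Bb] and [Bk] bound the coefficient of the treated residual without its propensity factor,
    the coefficient of the untreated residual, and [kappa x / D]. *)
Let Br := (1 + `|c2|) * `|D^-1|.
Let Bb := (`|g - c1| + `|c2|) * `|D^-1|.
Let Bk := (`|- g| + `|1| + `|g - c1| + `|- c2|) * `|D^-1|.

Let by1 (y : bool) (b : R) : 0 <= b <= 1 -> `|y%:R - b| <= 1.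
Proof.
by case: y => /andP[b0 b1]; rewrite ?mulr1n ?mulr0n ler_norml; apply/andP; split; lra.
Qed.

(** The quotient a/e is the only unbounded factor. It is kept explicit because it cancels once
    integrated against the density. *)
Lemma gradient_bound y a x : `|gradient y a x| <= Br * (a%:R / e x) + (Bb + Bk).
Proof.
have u01 : 0 <= u x <= 1.
  by rewrite (outd_le1 _ _ _ c0_model) (outd_ge0 _ _ _ c0_model).
have w01 : 0 <= w x <= 1.
  by rewrite (outd_le1 _ _ _ c0_model) (outd_ge0 _ _ _ c0_model).
have /andP[e0 e1] := e01 x.
have b1 : `|a%:R * ((1 - e x) / e x * ((1 - c2 * w x) / D) * (y%:R - u x))|
    <= Br * (a%:R / e x).
  have -> : a%:R * ((1 - e x) / e x * ((1 - c2 * w x) / D) * (y%:R - u x)) =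
    (1 - c2 * w x) * D^-1 * ((a%:R / e x) * ((1 - e x) * (y%:R - u x))) by ring.
  apply: normM_le.
    apply: normM_le => //; apply: (le_trans (ler_normB _ _)); rewrite normr1.
    by apply: lerD => //; rewrite -[leRHS]mulr1; exact: normM_le.
  rewrite -[leRHS]mulr1; apply: normM_le.
    by rewrite ger0_norm// divr_ge0// ltW.
  rewrite -[leRHS]mulr1; apply: normM_le; last exact: by1.
  by rewrite ger0_norm; lra.
have b2 : `|(1 - a%:R) * ((g - c1 - c2 * u x) / D * (y%:R - w x))| <= Bb.
  rewrite -[leRHS]mul1r; apply: normM_le.
    by case: a {b1} => /=; rewrite ?subrr ?subr0 ?normr0 ?normr1.
  rewrite -[leRHS]mulr1; apply: normM_le; last exact: by1.
  apply: normM_le => //; apply: (le_trans (ler_normB _ _)); apply: lerD => //.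
  by rewrite -[leRHS]mulr1; exact: normM_le.
have b3 : `|kappa x / D * (a%:R - 1)| <= Bk.
  rewrite -[leRHS]mulr1; apply: normM_le.
    apply: normM_le => //; exact: (bilin_bound _ _ _ _ _ c0_model).
  by case: a {b1 b2} => /=; rewrite ?subrr ?sub0r ?normrN ?normr0 ?normr1.
apply: (le_trans (ler_normB _ _)); rewrite addrA; apply: lerD => //.
by apply: (le_trans (ler_normD _ _)); exact: lerD.
Qed.

(** The two treated cells together have density e f, so a/e summed against the densities of all
    cells gives f; the bound thus integrates to a finite constant without any lower bound on e. *)
Lemma gradient_Lfun1 : at_obs Y A X gradient \in Lfun P 1.
Proof.
apply: (at_obs_Lfun1 mY mA mX c0_model obs_law) => [y a|].
  exact: measurable_gradient.
have mo y a := measurable_obs_density y a c0_model.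
have o0 y a x := obs_density_ge0 y a x c0_model.
apply: (@le_lt_trans _ _ (\int[nu]_x ((Br + (Bb + Bk)) * covd c0 x)%:E)%E).
  apply: ge0_le_integral => //.
  - move=> x _; rewrite lee_fin sumr_ge0// => y _; rewrite sumr_ge0// => a _.
    by rewrite mulr_ge0.
  - apply/measurable_EFinP; do 2![apply: measurable_sum => ?].
    by apply: measurable_funM => //; exact/measurableT_comp/measurable_gradient.
  - by apply/measurable_EFinP; apply: measurable_funM => //; case: c0_model => -[_ []].
  move=> x _; rewrite lee_fin.
  apply: (@le_trans _ _ (\sum_(y : bool) \sum_(a : bool)
      (Br * (a%:R / e x) + (Bb + Bk)) * obs_density c0 y a x)).
    by do 2![apply: ler_sum => ? _]; rewrite ler_wpM2r// gradient_bound.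
  rewrite !big_bool /obs_density/= !outd_false -/(u x) -/(w x) -/(e x).
  by rewrite le_eqVlt; apply/orP; left; apply/eqP; field; rewrite e_neq0.
apply: integrable_lty => //.
apply: (in_model_integrable (h := fun=> Br + (Bb + Bk)) c0_model) => // x.
Qed.

(** Summed over the cells, both residual terms vanish, and the last term leaves kappa (1 - e) f / D,
    whose integral is 0 by [integral_untreated0]. *)
Lemma gradient_mean0 : ('E_P[at_obs Y A X gradient] = 0)%E.
Proof.
have [_ ->] := integral_at_obs mY mA mX c0_model obs_law measurable_gradient
  gradient_Lfun1.
have iu := untreated_integrable (- g) 1 (g - c1) (- c2) c0_model.
transitivity (\int[nu]_x
    ((D^-1)%:E * (untreated (- g) 1 (g - c1) (- c2) c0 x)%:E))%E.
  apply: eq_integral => x _; rewrite -EFinM; congr EFin.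
  rewrite !big_bool /obs_density/= /gradient !outd_false /untreated -/kappa.
  by rewrite -/(u x) -/(w x) -/(e x) /=; field; rewrite D0 e_neq0.
rewrite integralZl//.
have /fineK <- := integrable_fin_num measurableT iu.
by have -> : fine (\int[nu]_x (untreated (- g) 1 (g - c1) (- c2) c0 x)%:E)%E = 0
  := integral_untreated0; rewrite mule0.
Qed.

Section version.
Variable psi : bool -> bool -> T -> R.
Hypotheses (mpsi : forall y a, measurable_fun setT (psi y a))
  (psiE : {ae P, forall w, at_obs Y A X gradient w = at_obs Y A X psi w}).

(** Integrating [gradient_score] over x yields the derivative of [gamma_coef], and [integral_at_obs]
    reads the same integral as an expectation. Passing to [psi] changes integrands on a null set
    only. *)
Lemma gradient_influence (Gamma : components T R -> R) :
  (forall c, in_model nu c -> Gamma c = gamma_coef nu c1 c2 c) ->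
  influence_function P nu Y A X c0 Gamma psi.
Proof.
move=> GammaE.
have mpo := measurable_at_obs mY mA mX mpsi.
have mgo := measurable_at_obs mY mA mX measurable_gradient.
split => //.
- exact: ae_Lfun1 psiE gradient_Lfun1.
- by rewrite -gradient_mean0; apply: ae_expectation => //; apply: filterS psiE => z ->.
move=> k M t0 regM j psi_s.
have ms y a := measurable_score j regM y a.
have mso := measurable_at_obs mY mA mX ms.
pose gs y a x := gradient y a x * score M t0 j y a x.
have mgs y a : measurable_fun setT (gs y a).
  by apply: measurable_funM; [exact: measurable_gradient|exact: ms].
have mgso := measurable_at_obs mY mA mX mgs.
have gsE : {ae P, forall w, at_obs Y A X psi w * at_obs Y A X (score M t0 j) w =
    at_obs Y A X gs w}.
  by apply: filterS psiE => z <-.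
have igs : at_obs Y A X gs \in Lfun P 1 by exact: ae_Lfun1 gsE psi_s.
have [ip pE] := integral_at_obs mY mA mX c0_model obs_law mgs igs.
have <- : fine 'E_P[at_obs Y A X gs]%E =
    fine 'E_P[fun w => (at_obs Y A X psi w * at_obs Y A X (score M t0 j) w)%R]%E.
  congr fine; apply: ae_expectation => //; first exact: measurable_funM.
  by apply: filterS gsE => z ->.
apply: (@near_eq_is_derive _ _ _ (fun t => gamma_coef nu c1 c2 (M t))).
  by have [_ _ [G [_ nM]]] := regM; apply: filterS nM => t [mt _]; rewrite GammaE.
apply: is_derive_ext (is_derive_gamma_coef j regM c1 c2 D0) => //.
rewrite pE -RintegralZl//.
  by congr fine; apply: eq_integral => x _; rewrite -(gradient_score j x regM).
(* Integrability of the derivative of [untreated] is recovered from that of gradient times score,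
   which is the same function divided by [D]. *)
have := integrableZl measurableT D ip.
apply: eq_integrable => // x _.
by rewrite /gs /= (gradient_score j x regM) -EFinM mulrA divff// mul1r.
Qed.

Lemma gradient_in_tangent_space : in_tangent_space P nu Y A X c0 psi.
Proof.
exists (fun a y x => if a then (1 - e x) / e x * ((1 - c2 * w x) / D) * (y%:R - u x)
                     else (g - c1 - c2 * u x) / D * (y%:R - w x)).
(* Both witnesses come from writing a - 1 = (a - e) - (1 - e) in the last term of [gradient]. *)
exists (fun x => - kappa x / D), (fun x => kappa x / D * (1 - e x)).
split.
- split=> [[] y|[] x].
  + apply: measurable_funM; last exact: measurable_funB.
    apply: measurable_funM => //; apply: measurable_funM => //.
    by apply: measurable_funB => //; exact: measurable_funM.
  + apply: measurable_funM; last exact: measurable_funB.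
    apply: measurable_funM => //; apply: measurable_funB => //.
    exact: measurable_funM.
  + by rewrite big_bool/= outd_false -/(u x); ring.
  + by rewrite big_bool/= outd_false -/(w x); ring.
- have mkD : measurable_fun setT (fun x => - kappa x / D).
    by apply: measurable_funM => //; exact: measurableT_comp.
  split=> //; apply: (@bounded_Lfun2 _ _ _ _ _ Bk).
    exact: measurableT_comp.
  move=> z /=; apply: normM_le => //; rewrite normrN.
  exact: (bilin_bound _ _ _ _ _ c0_model).
- have E x : kappa x / D * (1 - e x) * covd c0 x =
      D^-1 * untreated (- g) 1 (g - c1) (- c2) c0 x.
    by rewrite /untreated -/kappa -/(e x); ring.
  have iu := untreated_integrable (- g) 1 (g - c1) (- c2) c0_model.
  split.
  + by apply: measurable_funM; [exact: measurable_funM|exact: measurable_funB].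
  + have := integrableZl measurableT D^-1 iu; apply: eq_integrable => // x _.
    by rewrite /= -EFinM E.
  + under eq_Rintegral do rewrite E.
    by rewrite RintegralZl// integral_untreated0 mulr0.
- apply: filterS psiE => z <-; rewrite /at_obs /gradient.
  by rewrite -/(e (X z)); ring.
Qed.

End version.

End canonical_gradient.

(** * Submodels with a given bounded score *)

Section bounded_direction.
Context d d' (U : measurableType d) (T : measurableType d') (R : realType).
Variables (P : probability U R) (nu : {measure set T -> \bar R}).
Variables (Y A : U -> bool) (X : U -> T) (c0 : components T R).
Hypotheses (mY : measurable_fun setT Y) (mA : measurable_fun setT A)
  (mX : measurable_fun setT X).
Hypothesis c0_model : in_model nu c0.
Hypothesis obs_law : forall y a (B : set T), measurable B ->
  P (cell Y A y a `&` X @^-1` B) = (\int[nu]_(x in B) (obs_density c0 y a x)%:E)%E.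
Variables (h : bool -> bool -> T -> R) (C : R).
Hypotheses (mh : forall y a, measurable_fun setT (h y a)) (C0 : 0 < C)
  (hC : forall y a x, `|h y a x| <= C).
Hypothesis h_mean0 : ('E_P[at_obs Y A X h] = 0)%E.

Let o := outd c0.
Let e := prop c0.
Let f := covd c0.

Let hm a x := o a true x * h true a x + o a false x * h false a x.
Let sY a y x := h y a x - hm a x.
Let alpha x := hm true x - hm false x.
Let s x := e x * hm true x + (1 - e x) * hm false x.
Let tau (t : 'rV[R]_1) : R := t 0 0.

(* The score of this submodel is h: h is split into its deviation sY from its mean
   given (A, X), the effect alpha of A on that mean, and its mean s given X. *)
Definition tilted (t : 'rV[R]_1) : components T R :=
  Components (fun a y x => o a y x + tau t * (o a y x * sY a y x))
    (fun x => e x + tau t * (alpha x * (e x * (1 - e x))))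
    (fun x => f x + tau t * (f x * s x)).

Let e01 x : 0 < e x < 1. Proof. by case: c0_model => _ _ /(_ x). Qed.
Let o0 a y x : 0 <= o a y x. Proof. exact: outd_ge0 c0_model. Qed.
Let o1 a x : o a true x + o a false x = 1.
Proof. by case: c0_model => _ /(_ a x)[]. Qed.
Let f0 x : 0 <= f x. Proof. by case: c0_model. Qed.
Let mo a y : measurable_fun setT (o a y).
Proof. by case: c0_model => -[+ _] _ _ _ _; exact. Qed.
Let me : measurable_fun setT e. Proof. by case: c0_model => -[_ []]. Qed.
Let mf : measurable_fun setT f. Proof. by case: c0_model => -[_ []]. Qed.

Let mhm a : measurable_fun setT (hm a).
Proof. by apply: measurable_funD; exact: measurable_funM. Qed.
Let msY a y : measurable_fun setT (sY a y).
Proof. exact: measurable_funB. Qed.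
Let malpha : measurable_fun setT alpha.
Proof. exact: measurable_funB. Qed.
Let ms : measurable_fun setT s.
Proof.
by apply: measurable_funD; apply: measurable_funM => //; exact: measurable_funB.
Qed.

Let convC (a b u v : R) : 0 <= a -> 0 <= b -> a + b = 1 ->
  `|u| <= C -> `|v| <= C -> `|a * u + b * v| <= C.
Proof.
move=> a0 b0 ab; rewrite !ler_norml => /andP[u1 u2] /andP[v1 v2].
by apply/andP; split; nra.
Qed.

Let hmC a x : `|hm a x| <= C. Proof. exact: convC. Qed.
Let sYC a y x : `|sY a y x| <= 2 * C.
Proof.
rewrite (_ : 2 * C = C + C); last by ring.
by apply: (le_trans (ler_normB _ _)); apply: lerD.
Qed.
Let alphaC x : `|alpha x| <= 2 * C.
Proof.
rewrite (_ : 2 * C = C + C); last by ring.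
by apply: (le_trans (ler_normB _ _)); apply: lerD.
Qed.
Let sC x : `|s x| <= C.
Proof. by have /andP[? ?] := e01 x; apply: convC => //; lra. Qed.

Let leC2 : C <= 2 * C. Proof. by rewrite mulr_natl mulr2n lerDl ltW. Qed.

Lemma tilted0 : tilted 0 = c0.
Proof.
rewrite /tilted /tau mxE /o /e /f; case: (c0) => oo ee ff /=; congr Components.
- by do 3![apply/funext => ?]; rewrite mul0r addr0.
- by apply/funext => ?; rewrite mul0r addr0.
- by apply/funext => ?; rewrite mul0r addr0.
Qed.

Lemma is_derive_affine (a b : R) t (j : 'I_1) :
  is_derive t (delta_mx 0 j : 'rV[R]_1) (fun t => a + tau t * b) b.
Proof.
have dtau : is_derive t (delta_mx 0 j : 'rV[R]_1) tau 1.
  have tE : (fun u : R => tau (u *: delta_mx 0 j + t)) = fun u => u + tau t.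
    by apply/funext => u; rewrite /tau !mxE !ord1 eqxx mulr1.
  have [D1 D2] : is_derive (0 : R) 1 (fun u : R => tau (u *: delta_mx 0 j + t)) 1.
    have did : is_derive (0 : R) 1 (fun u : R => u) 1 by exact: is_derive_id.
    have := is_derive_add did (is_derive_const (tau t) (0 : R) 1).
    by rewrite tE addr0.
  split.
    by move/(derivable_line tau t (delta_mx 0 j) 0).1 : D1; rewrite scale0r add0r.
  by move: D2; rewrite (derive_line tau t (delta_mx 0 j) 0) scale0r add0r.
apply: is_derive_ext (is_derive_add (is_derive_const a t _)
  (is_derive_mul dtau (is_derive_const b t _))) => //.
by rewrite mulr0 addr0 mul1r add0r.
Qed.

(** At 0 the logarithmic derivatives of e and 1 - e are alpha (1 - e) and - alpha e, which is why
    the propensity is tilted by e (1 - e). Adding [sY] and [s], the conditional means cancel and [h]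
    remains. *)
Lemma is_derive_tilted y a x j : is_derive (0 : 'rV[R]_1) (delta_mx 0 j)
  (fun t => obs_density (tilted t) y a x) (obs_density c0 y a x * h y a x).
Proof.
have do_ := is_derive_affine (o a y x) (o a y x * sY a y x) 0 j.
have de := is_derive_affine (e x) (alpha x * (e x * (1 - e x))) 0 j.
have de' := is_derive_affine (1 - e x) (- (alpha x * (e x * (1 - e x)))) 0 j.
have df := is_derive_affine (f x) (f x * s x) 0 j.
have t0 : tau 0 = 0 by rewrite /tau mxE.
rewrite /obs_density; case: a do_ => do_.
  apply: is_derive_ext (is_derive_mul (is_derive_mul do_ de) df) => //.
  by rewrite t0 /sY /alpha /s -/o -/e -/f; ring.
apply: is_derive_ext (is_derive_mul (is_derive_mul do_ de') df) => [t|].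
  by rewrite /tilted /=; ring.
by rewrite t0 /sY /alpha /s -/o -/e -/f; ring.
Qed.

(** The quotient is left unsimplified: where the density vanishes it equals 0, not [h]. *)
Lemma score_tilted y a x j : score tilted 0 j y a x
  = obs_density c0 y a x * h y a x / obs_density c0 y a x.
Proof. by rewrite /score tilted0 /partial; have [_ ->] := is_derive_tilted y a x j. Qed.

Lemma score_tilted_bound y a x j : `|score tilted 0 j y a x| <= C.
Proof.
rewrite score_tilted; have [->|p0] := eqVneq (obs_density c0 y a x) 0.
  by rewrite invr0 mulr0 normr0 ltW.
by rewrite mulrAC divff// mul1r.
Qed.

Lemma measurable_score_tilted y a j : measurable_fun setT (score tilted 0 j y a).
Proof.
rewrite (_ : score _ _ _ _ _ = fun x =>
  obs_density c0 y a x * h y a x / obs_density c0 y a x); last first.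
  by apply/funext => x; rewrite score_tilted.
have mp := measurable_obs_density y a c0_model.
apply: measurable_funM; first exact: measurable_funM.
by apply: measurable_ge0_inv => // x; exact: obs_density_ge0 c0_model.
Qed.

(** The function f s is the sum over the cells of [h] times the density, so its integral is E[h] =
    0. This keeps the total mass of the tilted covariate density equal to 1. *)
Lemma integral_covd_tilt : nu.-integrable setT (fun x => (f x * s x)%:E) /\
  (\int[nu]_x (f x * s x)%:E = 0)%E.
Proof.
have ih : at_obs Y A X h \in Lfun P 1.
  apply: (@bounded_Lfun1 _ _ _ _ _ C); last by move=> w; exact: hC.
  exact: measurable_at_obs.
have [ip pE] := integral_at_obs mY mA mX c0_model obs_law mh ih.
have E x : \sum_(y : bool) \sum_(a : bool) h y a x * obs_density c0 y a x = f x * s x.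
  by rewrite !big_bool /obs_density/= /s /hm -/o -/e -/f; ring.
have EE : (fun x => (\sum_(y : bool) \sum_(a : bool)
    h y a x * obs_density c0 y a x)%:E) = (fun x => (f x * s x)%:E).
  by apply/funext => x; rewrite E.
by rewrite EE in ip pE; split=> //; rewrite -pE h_mean0.
Qed.

(** All tilts are bounded by 2 C, so for a parameter of size at most 1/(4 C) each relative
    perturbation is at most 1/2 and every component keeps its sign or range. *)
Lemma tilted_in_model t : `|tau t| <= (4 * C)^-1 -> in_model nu (tilted t).
Proof.
move=> tC.
have small b : `|b| <= 2 * C -> `|tau t * b| <= 2^-1.
  move=> bC; rewrite (_ : 2^-1 = (4 * C)^-1 * (2 * C)); first exact: normM_le.
  by field; rewrite gt_eqF.
have [ifs ifs0] := integral_covd_tilt.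
split=> /=.
- split=> [a y|]; last split.
  + by apply: measurable_funD => //; do 2?[apply: measurable_funM => //].
  + apply: measurable_funD => //; apply: measurable_funM => //.
    by do 2?[apply: measurable_funM => //]; exact: measurable_funB.
  + by apply: measurable_funD => //; do 2?[apply: measurable_funM => //].
- move=> a x; split=> [|y].
    have -> : o a false x = 1 - o a true x by rewrite -(o1 a x) addrAC subrr add0r.
    rewrite /sY /hm (_ : o a false x = 1 - o a true x); last first.
      by rewrite -(o1 a x) addrAC subrr add0r.
    by ring.
  have := small _ (sYC a y x); rewrite ler_norml => /andP[b1 b2].
  by rewrite mulrCA -[X in X + _]mulr1 -mulrDr mulr_ge0//; lra.
- move=> x; have /andP[e0 e1] := e01 x.
  have := small _ (alphaC x); rewrite ler_norml => /andP[b1 b2].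
  rewrite mulrA; move: (tau t * alpha x) b1 b2 => z b1 b2; apply/andP; split.
    have -> : e x + z * (e x * (1 - e x)) = e x * (1 + z * (1 - e x)) by ring.
    by rewrite mulr_gt0//; nra.
  rewrite -subr_gt0.
  have -> : 1 - (e x + z * (e x * (1 - e x))) = (1 - e x) * (1 - z * e x) by ring.
  by rewrite mulr_gt0//; nra.
- move=> x; have sx : `|s x| <= 2 * C.
    exact: le_trans (sC x) leC2.
  have := small _ sx; rewrite ler_norml => /andP[b1 b2].
  by rewrite mulrCA -[X in X + _]mulr1 -mulrDr mulr_ge0//; lra.
- have iff : nu.-integrable setT (EFin \o f).
    have : nu.-integrable setT (fun x => (1 * f x)%:E).
      apply: (in_model_integrable (h := fun=> 1) (C := 1) c0_model) => // x.
      by rewrite normr1.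
    by apply: eq_integrable => // x _; rewrite mul1r.
  under eq_integral do rewrite EFinD EFinM.
  rewrite integralD//; last exact: integrableZl.
  rewrite integralZl// ifs0 mule0 adde0.
  by case: c0_model.
Qed.

Lemma tilted_regular : regular_submodel P nu Y A X c0 tilted 0.
Proof.
split; first exact: tilted0.
  move=> j; apply: (@bounded_Lfun2 _ _ _ _ _ C).
    by apply: measurable_at_obs => // y a; exact: measurable_score_tilted.
  by move=> w; exact: score_tilted_bound.
(* Regularity weights the derivatives of the outcome and propensity components by the tilted density
   at [t], not the true one. That density is at most 2 f and those derivatives are at most 2 C,
   whence 4 C f. *)
exists (fun x => 4 * C * f x); split.
  apply: (in_model_integrable (h := fun=> 4 * C) (C := `|4 * C|) c0_model) => //.
have : \forall t \near (0 : 'rV[R]_1), `|tau t| <= (4 * C)^-1.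
  have C4 : 0 < (4 * C)^-1 by rewrite invr_gt0 mulr_gt0.
  apply/nbhs_ballP; exists (4 * C)^-1 => //= t.
  by rewrite /ball/= => -[_ /(_ 0 0)]; rewrite /ball/= mxE sub0r normrN => /ltW.
apply: filterS => t tC; split; first exact: tilted_in_model.
have tb b : `|b| <= 2 * C -> `|tau t * b| <= 1.
  move=> bC; apply: (@le_trans _ _ ((4 * C)^-1 * (2 * C))); first exact: normM_le.
  by rewrite ler_pdivrMl ?mulr_gt0// mulr1 ler_pM2r// ler_nat.
move=> j x.
have c2 : `|f x + tau t * (f x * s x)| <= 2 * f x.
  rewrite mulrCA -[X in `|X + _|]mulr1 -mulrDr mulrC; apply: normM_le.
    rewrite (le_trans (ler_normD _ _))// normr1 (_ : 2 = 1 + 1) ?lerD//.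
    by apply: tb; exact: le_trans (sC x) leC2.
  by rewrite ger0_norm.
have fE : `|f x + tau t * (f x * s x)| = f x + tau t * (f x * s x).
  by rewrite ger0_norm//; case: (tilted_in_model tC) => _ _ _ /(_ x).
have GE : 4 * C * f x = (1 * (2 * C)) * (2 * f x) by ring.
have /andP[e0 e1] := e01 x.
split=> /=.
- move=> a y; have [D1 D2] := is_derive_affine (o a y x) (o a y x * sY a y x) t j.
  split=> //; rewrite /partial D2 -fE GE -normrM; apply: normM_le => //.
  apply: normM_le => //; rewrite ger0_norm//.
  by rewrite -(o1 a x); case: y {D1 D2}; rewrite ?lerDl ?lerDr.
- have [D1 D2] := is_derive_affine (e x) (alpha x * (e x * (1 - e x))) t j.
  split=> //; rewrite /partial D2 -fE GE -normrM; apply: normM_le => //.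
  by rewrite mulrC; apply: normM_le => //; rewrite ger0_norm; nra.
- have [D1 D2] := is_derive_affine (f x) (f x * s x) t j.
  split=> //; rewrite /partial D2 mulrC; apply: normM_le; last by rewrite ger0_norm.
  by apply: (le_trans (sC x)); rewrite ler_peMl ?(ltW C0)// ler1n.
Qed.

End bounded_direction.

(** * Uniqueness of the influence function *)

Section uniqueness.
Context d d' (U : measurableType d) (T : measurableType d') (R : realType).
Variables (P : probability U R) (nu : {measure set T -> \bar R}).

Lemma mul_bounded_Lfun1 (f g : U -> R) (C : R) : f \in Lfun P 1 ->
  measurable_fun setT g -> (forall w, `|g w| <= C) ->
  (fun w => f w * g w) \in Lfun P 1.
Proof.
move=> /Lfun1_integrable fi mg gC; apply/Lfun1_integrable.
have mf : measurable_fun setT f by apply/measurable_EFinP; exact: measurable_int fi.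
apply: (@le_integrable _ _ _ _ _ measurableT _ (fun w => C%:E * (f w)%:E)%E).
- by apply/measurable_EFinP; exact: measurable_funM.
- move=> w _ /=; rewrite lee_fin !normrM mulrC ler_wpM2r//.
  exact: le_trans (gC w) (ler_norm _).
- exact: integrableZl.
Qed.

Variables (Y A : U -> bool) (X : U -> T) (c0 : components T R).
Hypotheses (mY : measurable_fun setT Y) (mA : measurable_fun setT A)
  (mX : measurable_fun setT X).
Hypothesis c0_model : in_model nu c0.
Hypothesis obs_law : forall y a (B : set T), measurable B ->
  P (cell Y A y a `&` X @^-1` B) = (\int[nu]_(x in B) (obs_density c0 y a x)%:E)%E.

Lemma influence_function_unique (Gamma : components T R -> R)
    (psi psi' : bool -> bool -> T -> R) :
  influence_function P nu Y A X c0 Gamma psi ->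
  influence_function P nu Y A X c0 Gamma psi' ->
  {ae P, forall w, at_obs Y A X psi' w = at_obs Y A X psi w}.
Proof.
move=> [mp ip p0 pG] [mp' ip' p0' pG'].
pose delta y a x := psi' y a x - psi y a x.
(* sigma is the sign of delta, as 0 * 0^-1 = 0. *)
pose sigma y a x := delta y a x * `|delta y a x|^-1.
have mdelta y a : measurable_fun setT (delta y a) by exact: measurable_funB.
have msigma y a : measurable_fun setT (sigma y a).
  apply: measurable_funM => //; apply: measurable_ge0_inv => //.
  exact: measurableT_comp.
have sigma1 y a x : `|sigma y a x| <= 1.
  rewrite /sigma; have [->|d0] := eqVneq (delta y a x) 0.
    by rewrite mul0r normr0 ler01.
  by rewrite normrM normrV ?unitfE ?normr_eq0// normr_id divff// normr_eq0.
have deltaE y a x : delta y a x * sigma y a x = `|delta y a x|.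
  rewrite /sigma; have [->|d0] := eqVneq (delta y a x) 0.
    by rewrite mul0r normr0.
  rewrite mulrA -expr2 -real_normK ?num_real// expr2 mulfK// normr_eq0//.
have isigma : at_obs Y A X sigma \in Lfun P 1.
  apply: (@bounded_Lfun1 _ _ _ _ _ 1); last by move=> w; exact: sigma1.
  exact: measurable_at_obs.
have Esigma := expectation_fin_num isigma.
pose m := fine ('E_P[at_obs Y A X sigma])%E.
pose h y a x := sigma y a x - m.
have mh y a : measurable_fun setT (h y a) by exact: measurable_funB.
pose C := 1 + `|m|.
have C0 : 0 < C by rewrite ltr_pwDl.
have hC y a x : `|h y a x| <= C.
  by apply: (le_trans (ler_normB _ _)); rewrite lerD2r.
have h0 : ('E_P[at_obs Y A X h] = 0)%E.
  rewrite (_ : at_obs Y A X h = at_obs Y A X sigma \- cst m)//.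
  rewrite expectationB//; last exact: Lfun_cst.
  by rewrite expectation_cst /m fineK// subee.
have regM := tilted_regular mY mA mX c0_model obs_law mh C0 hC h0.
set M := tilted c0 h in regM.
pose s := at_obs Y A X (score M 0 ord0).
have ms : measurable_fun setT s.
  apply: measurable_at_obs => // y a.
  exact: (measurable_score_tilted c0_model).
have sC w : `|s w| <= C by exact: (score_tilted_bound c0 C0 hC).
(* Boundedness of the score gives the integrability that the derivative formula requires. Both
   expectations are then the derivative of the same function, hence equal. *)
have ips := mul_bounded_Lfun1 ip ms sC.
have ips' := mul_bounded_Lfun1 ip' ms sC.
have [_ D1] := pG _ _ _ regM ord0 ips.
have [_ D2] := pG' _ _ _ regM ord0 ips'.
have Eps := expectation_fin_num ips.
have Eps' := expectation_fin_num ips'.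
have Ed : at_obs Y A X delta \in Lfun P 1.
  apply/Lfun1_integrable; have := integrableB measurableT
    ((Lfun1_integrable _ _).1 ip') ((Lfun1_integrable _ _).1 ip).
  by apply: eq_integrable.
have Edelta : ('E_P[at_obs Y A X delta] = 0)%E.
  rewrite (_ : at_obs Y A X delta = at_obs Y A X psi' \- at_obs Y A X psi)//.
  by rewrite expectationB// p0 p0' sube0.
have Eds : ('E_P[fun w => (at_obs Y A X delta w * s w)%R] = 0)%E.
  rewrite (_ : (fun w => _) = (fun w => at_obs Y A X psi' w * s w)
    \- (fun w => at_obs Y A X psi w * s w)); last first.
    by apply/funext => w; rewrite /at_obs/= /delta mulrBl.
  rewrite expectationB// -(fineK Eps) -(fineK Eps') -EFinB; congr EFin.
  by rewrite -D1 -D2 subrr.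
(* The score equals [h] where the density is nonzero, which holds almost surely at (Y, A, X). *)
have sE : {ae P, forall w, at_obs Y A X delta w * s w =
    `|at_obs Y A X delta w| - m * at_obs Y A X delta w}.
  have := ae_obs_density_neq0 mY mA mX c0_model obs_law.
  apply: filterS => w pn0; rewrite /s /at_obs (score_tilted c0 h).
  by rewrite mulrAC divff// mul1r /h mulrBr deltaE [m * _]mulrC.
have mdo := measurable_at_obs mY mA mX mdelta.
have Eabs : ('E_P[fun w => `|at_obs Y A X delta w|%R] = 0)%E.
  rewrite -Eds; have id := Lfun_norm Ed.
  rewrite (@ae_expectation _ _ _ P (fun w => at_obs Y A X delta w * s w)
    (fun w => `|at_obs Y A X delta w| - m * at_obs Y A X delta w))//; last 2 first.
  - exact: measurable_funM.
  - by apply: measurable_funB; [exact: measurableT_comp|exact: measurable_funM].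
  rewrite (_ : (fun w => _ - _) = (Num.norm \o at_obs Y A X delta)
      \- (m \o* at_obs Y A X delta)); last first.
    by apply/funext => w /=; rewrite mulrC.
  rewrite expectationB//; last exact: Lfun_scale.
  by rewrite expectationZl// Edelta mule0 sube0.
have : ae_eq P setT (EFin \o at_obs Y A X delta) (cst 0%E).
  apply/(ae_eq_integral_abs P measurableT).
    exact/measurable_EFinP.
  by move: Eabs; rewrite unlock.
apply: filterS => w /(_ I) [] /eqP; rewrite /at_obs /delta subr_eq0 => /eqP.
by [].
Qed.

End uniqueness.

(** * Identification *)

Section identification.
Context d d' (U : measurableType d) (T : measurableType d') (R : realType).
Variables (P : probability U R) (nu : {measure set T -> \bar R}).
Variables (X : U -> T) (A Y0 Y1 : U -> bool) (Y : U -> bool).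
Variables (f e : T -> R) (f0 f1 : bool -> T -> R) (mu : bool -> T -> R).
Hypotheses (mX : measurable_fun setT X) (mA : measurable_fun setT A)
  (mY0 : measurable_fun setT Y0) (mY1 : measurable_fun setT Y1).
Hypothesis hY : forall w, Y w = if A w then Y1 w else Y0 w.
Hypothesis hf : is_density P nu X f.
Hypothesis he : is_cond_prob P X [set w | A w] e.
Hypothesis hmu : is_cond_prob P (fun w => (X w, A w)) [set w | Y w]
  (fun xa => mu xa.2 xa.1).
Hypotheses (hf0 : is_cond_pmf P X Y0 f0) (hf1 : is_cond_pmf P X Y1 f1).
Hypothesis ignorability : cond_indep P X (fun w => (Y0 w, Y1 w)) A.
Hypothesis positivity : forall x, 0 < e x < 1.

Let c0 := Components (fun a => if a then f1 else f0) e f.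
Let Ya a := if a then Y1 else Y0.
Let ea (a : bool) x := if a then e x else 1 - e x.

Let mpre (V : U -> bool) y : measurable_fun setT V -> measurable (V @^-1` [set y]).
Proof. by move=> mV; rewrite -[X in measurable X]setTI; exact: mV. Qed.

Let mYa a : measurable_fun setT (Ya a). Proof. by case: a. Qed.
Let hYa a : is_cond_pmf P X (Ya a) (outd c0 a). Proof. by case: a. Qed.

Let me : measurable_fun setT e. Proof. by case: he. Qed.
Let mea a : measurable_fun setT (ea a).
Proof. by case: a => //; exact: measurable_funB. Qed.
Let ea_gt0 a x : 0 < ea a x.
Proof. by case: a => /=; have /andP[? ?] := positivity x; rewrite ?subr_gt0. Qed.
Let mo a y : measurable_fun setT (outd c0 a y).
Proof. by have [/(_ y)[]] := hYa a. Qed.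
Let o_ge0 a y x : 0 <= outd c0 a y x.
Proof. by have [_ + _] := hYa a; exact. Qed.
Let mf : measurable_fun setT f. Proof. by case: hf. Qed.
Let f_ge0 x : 0 <= f x. Proof. by case: hf. Qed.

Let f_density B : measurable B ->
  P (setT `&` X @^-1` B) = (\int[nu]_(x in B) (f x)%:E)%E.
Proof. by move=> mB; rewrite setTI; have [_ _ ->] := hf. Qed.

Lemma measurable_observed : measurable_fun setT Y.
Proof.
rewrite (_ : Y = fun w => if A w then Y1 w else Y0 w); last exact/funext.
exact: measurable_fun_ifT.
Qed.
Let mY := measurable_observed.

Lemma truth_in_model : in_model nu c0.
Proof.
split=> //.
  by move=> a x; case: (hYa a) => _ _ o1; split=> // y; exact: o_ge0.
have [_ _ /(_ _ measurableT) <-] := hf.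
by rewrite preimage_setT probability_setT.
Qed.

Let cond_A a : is_cond_prob P X (A @^-1` [set a]) (ea a).
Proof.
case: a; first exact: he.
rewrite (_ : A @^-1` [set false] = ~` [set w | A w]).
  by apply: is_cond_prob_setC he => //; exact: (@mpre A true).
by apply/seteqP; split => w /=; case: (A w).
Qed.

Let V w := (Y0 w, Y1 w).

Let mV u : measurable (V @^-1` [set u]).
Proof.
rewrite (_ : _ @^-1` _ = Y0 @^-1` [set u.1] `&` Y1 @^-1` [set u.2]).
  by apply: measurableI; exact: mpre.
apply/seteqP; split => w; rewrite /V /=.
  by move=> <-.
by move=> [-> ->]; rewrite -surjective_pairing.
Qed.

(** In [u z], the bit [z] is the value of the other potential outcome. The arm [b] may differ from
    [a]: [a = b] gives the observed law, while [a = true] with [b = false] gives the counterfactual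
    probability used for identification. *)
Let cond_YA a y b : is_cond_prob P X (Ya a @^-1` [set y] `&` A @^-1` [set b])
  (fun x => outd c0 a y x * ea b x).
Proof.
pose u z : bool * bool := if a then (z, y) else (y, z).
have E : Ya a @^-1` [set y] = V @^-1` [set u true] `|` V @^-1` [set u false].
  apply/seteqP; split => w; rewrite /V /u /Ya /=; case: a {u}; case: (Y0 w);
    case: (Y1 w); case: y => //= H; do ?[by left|by right]; by case: H.
have := @cond_indepUM _ _ _ _ _ P X mX _ _ V A mV (fun b => mpre b mA) ignorability
  (u true) (u false) b (outd c0 a y) (ea b).
rewrite -E; apply.
- by rewrite /u; case: (a); rewrite xpair_eqE/= ?andbF.
- by have [/(_ y)] := hYa a.
- exact: cond_A.
Qed.

(** On the event A = a the observed outcome is the potential outcome [Ya a], so a cell is an event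
    covered by [cond_YA]; the integral over X is then moved to [nu]. *)
Lemma observed_law y a (B : set T) : measurable B ->
  P (cell Y A y a `&` X @^-1` B) = (\int[nu]_(x in B) (obs_density c0 y a x)%:E)%E.
Proof.
move=> mB; have [_ /(_ _ mB)] := cond_YA a y a.
have -> : Ya a @^-1` [set y] `&` A @^-1` [set a] = cell Y A y a.
  apply/seteqP; split => w; rewrite /cell /Ya/= hY => -[Hy Ha]; split => //.
    by rewrite Ha; case: (a) Hy.
  by move: Hy; rewrite Ha; case: (a).
move=> ->; rewrite -[X @^-1` B]setTI.
rewrite (ge0_integral_density_in mX measurableT mf f_ge0 f_density mB
  (G := fun x => (outd c0 a y x * ea a x)%:E)).
- by apply: eq_integral => x _; rewrite -EFinM /obs_density /ea; case: (a).
- by apply/measurable_EFinP; exact: measurable_funM.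
- by move=> x; rewrite lee_fin mulr_ge0// ltW.
Qed.

Lemma measurable_regression a : measurable_fun setT (mu a).
Proof.
have [mg _] := hmu.
have mx : measurable_fun setT (fun x : T => (x, a)) by exact: measurable_fun_pair.
exact: (measurableT_comp mg mx).
Qed.
Let mmu := measurable_regression.

(* mu is only determined along the law of (X, A); as e lies in ]0, 1[, a set of
   covariates that is null on {A = a} is null. *)
Lemma outcome_regressionE a : {ae P, forall w, mu a (X w) = outd c0 a true (X w)}.
Proof.
have mZ : measurable_fun setT (fun w => (X w, A w)).
  exact: measurable_fun_pair.
have msec (B : set (T * bool)) b : measurable B -> measurable [set x | B (x, b)].
  by move=> mB; have := measurable_ysection b mB; rewrite /ysection; congr measurable;
    apply/seteqP; split => x /=; rewrite inE.
(* The component of the truth is itself a version of the regression on (X, A), checked by cutting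
   [B] into its sections at the two values of A. Uniqueness then compares it with [mu]. *)
have hreg : is_cond_prob P (fun w => (X w, A w)) [set w | Y w]
    (fun xa => outd c0 xa.2 true xa.1).
  split.
    rewrite (_ : (fun xa : T * bool => _) = fun xa =>
      if xa.2 then f1 true xa.1 else f0 true xa.1); last first.
      by apply/funext => -[x []].
    apply: measurable_fun_ifT; first exact: measurable_snd.
      exact: measurableT_comp (mo true true) (measurable_fst).
    exact: measurableT_comp (mo false true) (measurable_fst).
  move=> B mB.
  pose D b := A @^-1` [set b] `&` X @^-1` [set x | B (x, b)].
  have mD b : measurable (D b).
    by apply: measurableI; [exact: mpre|exact: measurable_preimageT (msec _ _ mB)].
  have DE : (fun w => (X w, A w)) @^-1` B = D true `|` D false.
    apply/seteqP; split => w /=; rewrite /D /=.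
      by case: (A w) => ?; [left|right].
    by case=> -[/= Aw]; rewrite /preimage/= Aw.
  have D0 : [disjoint D true & D false].
    by apply/disj_setPS => w; rewrite /D /=; intuition congruence.
  rewrite DE integral_setU//; last first.
    apply/measurable_funTS/measurable_EFinP.
    have mop b : measurable_fun setT (fun w => outd c0 b true (X w)).
      exact: measurableT_comp.
    rewrite (_ : (fun w => _) = fun w =>
      if A w then f1 true (X w) else f0 true (X w)); last first.
      by apply/funext => w /=; case: (A w).
    by apply: measurable_fun_ifT => //; [exact: (mop true)|exact: (mop false)].
  have -> : [set w | Y w] `&` (D true `|` D false) =
      (cell Y A true true `&` X @^-1` [set x | B (x, true)]) `|`
      (cell Y A true false `&` X @^-1` [set x | B (x, false)]).
    by apply/seteqP; split => w; rewrite /D /cell /=; intuition.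
  transitivity (P (cell Y A true true `&` X @^-1` [set x | B (x, true)]) +
      P (cell Y A true false `&` X @^-1` [set x | B (x, false)]))%E.
    apply: measureU.
    - apply: measurableI; [exact: measurable_cell|exact: measurable_preimageT (msec _ _ mB)].
    - apply: measurableI; [exact: measurable_cell|exact: measurable_preimageT (msec _ _ mB)].
    - by apply/seteqP; split => w //=; rewrite /cell/=; intuition congruence.
  have H b : (\int[P]_(w in D b) (outd c0 (A w) true (X w))%:E =
      P (cell Y A true b `&` X @^-1` [set x | B (x, b)]))%E.
    rewrite observed_law; last exact: msec.
    rewrite (@eq_integral _ _ _ _ _ (fun w => (outd c0 b true (X w))%:E)); last first.
      by move=> w; rewrite inE => -[/= -> _].
    have A_density C : measurable C -> P (A @^-1` [set b] `&` X @^-1` C) =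
        (\int[nu]_(x in C) (ea b x * f x)%:E)%E.
      move=> mC; have [_ ->//] := cond_A b.
      rewrite -[X @^-1` C]setTI (ge0_integral_density_in mX measurableT mf f_ge0
        f_density mC (G := fun x => (ea b x)%:E))//.
      + exact/measurable_EFinP.
      + by move=> x; rewrite lee_fin ltW.
    rewrite (ge0_integral_density_in mX (mpre b mA)
      (measurable_funM (mea b) mf) _ A_density (msec _ b mB)
      (G := fun x => (outd c0 b true x)%:E)).
    - by apply: eq_integral => x _; rewrite -EFinM /obs_density /ea/= mulrA; case: (b).
    - by move=> x /=; rewrite mulr_ge0// ltW.
    - exact/measurable_EFinP.
    - by move=> x; rewrite lee_fin.
  by rewrite !H.
have mYs : measurable [set w | Y w] by exact: (mpre true mY).
have := is_cond_prob_unique mZ mYs hmu hreg.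
pose N := [set x | mu a x != outd c0 a true x].
have mN : measurable N.
  rewrite (_ : N = ~` ((fun x => mu a x - outd c0 a true x) @^-1` [set 0])).
    apply: measurableC; rewrite -[X in measurable X]setTI.
    exact: (measurable_funB (mmu a) (mo a true)).
  apply/seteqP; split => x; rewrite /N /= -subr_eq0; first by move/eqP.
  by move=> ?; apply/eqP.
move=> muE.
have N0 : P (A @^-1` [set a] `&` X @^-1` N) = 0%E.
  apply: measure_negligible.
    by apply: measurableI; [exact: mpre|exact: measurable_preimageT].
  apply: negligibleS muE => w /= [Aw]; rewrite /N/= => Nw; rewrite Aw => H.
  by rewrite H eqxx in Nw.
have [_ /(_ _ mN)] := cond_A a; rewrite N0 => /esym I0.
have : ae_eq P (X @^-1` N) (fun w => (ea a (X w))%:E) (cst 0%E).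
  apply/ae_eq_integral_abs.
  - exact: measurable_preimageT.
  - by apply/measurable_EFinP/measurable_funTS; exact: measurableT_comp.
  - rewrite -[RHS]I0; apply: eq_integral => w _.
    by rewrite gee0_abs// lee_fin ltW.
apply: filterS => w /= H; apply/eqP; apply: contrapT => /negP HN.
by have := H HN; move=> [/eqP]; rewrite gt_eqF.
Qed.

(** This links the constants defined as expectations involving [mu] with the integrals of components
    that enter [gamma_coef]. *)
Lemma expectation_untreated k0 k1 k2 k3 (h : T -> R) : measurable_fun setT h ->
  {ae P, forall w, h (X w) = bilin k0 k1 k2 k3 c0 (X w)} ->
  ('E_P[fun w => (h (X w) * (1 - e (X w)))%R]
   = (\int[nu]_x untreated k0 k1 k2 k3 c0 x)%:E)%E.
Proof.
move=> mh hE; have mb := measurable_bilin k0 k1 k2 k3 truth_in_model.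
have m1e : measurable_fun setT (fun w => 1 - e (X w)).
  by apply: measurable_funB => //; exact: measurableT_comp.
have mg : measurable_fun setT (fun x => bilin k0 k1 k2 k3 c0 x * (1 - e x)).
  by apply: measurable_funM => //; exact: measurable_funB.
have mgX : measurable_fun setT
    (fun w => bilin k0 k1 k2 k3 c0 (X w) * (1 - e (X w))).
  exact: (measurableT_comp mg mX).
rewrite (@ae_expectation _ _ _ P _
  (fun w => bilin k0 k1 k2 k3 c0 (X w) * (1 - e (X w))))//; last 2 first.
- by apply: measurable_funM => //; exact: (measurableT_comp mh mX).
- by apply: filterS hE => w ->.
have ig : (fun w => bilin k0 k1 k2 k3 c0 (X w) * (1 - e (X w))) \in Lfun P 1.
  apply: (@bounded_Lfun1 _ _ _ _ _ ((`|k0| + `|k1| + `|k2| + `|k3|) * 1)) => // w.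
  apply: normM_le; first exact: bilin_bound truth_in_model.
  have /andP[e0 e1] := positivity (X w).
  by rewrite ger0_norm; lra.
rewrite unlock.
have [_ ->] := integral_density mX measurableT mf f_ge0 f_density
  (G := fun x => (bilin k0 k1 k2 k3 c0 x * (1 - e x))%:E)
  ((measurable_EFinP _ _).2 mg) ((Lfun1_integrable _ _).1 ig).
have /(integrable_fin_num measurableT)/fineK <- :=
  untreated_integrable k0 k1 k2 k3 truth_in_model.
by [].
Qed.

Let I k0 k1 k2 k3 := \int[nu]_x untreated k0 k1 k2 k3 c0 x.

Lemma mub_true : mub P X e mu true = I 0 1 0 0.
Proof.
rewrite /mub (@expectation_untreated 0 1 0 0 _ (mmu true))//.
by apply: filterS (outcome_regressionE true) => w ->; rewrite /bilin; ring.
Qed.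

Lemma mub_false : mub P X e mu false = I 0 0 1 0.
Proof.
rewrite /mub (@expectation_untreated 0 0 1 0 _ (mmu false))//.
by apply: filterS (outcome_regressionE false) => w ->; rewrite /bilin; ring.
Qed.

Lemma mubb_true : mubb P X e mu true = I 1 (- 1) 0 0.
Proof.
rewrite /mubb (@expectation_untreated 1 (- 1) 0 0 (fun x => 1 - mu true x))//.
  exact: measurable_funB.
by apply: filterS (outcome_regressionE true) => w ->; rewrite /bilin; ring.
Qed.

Lemma mubb_false : mubb P X e mu false = I 1 0 (- 1) 0.
Proof.
rewrite /mubb (@expectation_untreated 1 0 (- 1) 0 (fun x => 1 - mu false x))//.
  exact: measurable_funB.
by apply: filterS (outcome_regressionE false) => w ->; rewrite /bilin; ring.
Qed.

Lemma mub10E : mub10 P X e mu = I 0 0 0 1.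
Proof.
rewrite /mub10 (@expectation_untreated 0 0 0 1 (fun x => mu true x * mu false x))//.
  exact: measurable_funM.
by apply: filterS2 (outcome_regressionE true) (outcome_regressionE false)
  => w -> ->; rewrite /bilin; ring.
Qed.

Lemma is_cond_prob_untreated k0 k1 k2 k3 E g : is_cond_prob P X E g ->
  (forall x, g x = bilin k0 k1 k2 k3 c0 x * (1 - e x)) ->
  P E = (I k0 k1 k2 k3)%:E.
Proof.
move=> [_ /(_ _ measurableT)]; rewrite preimage_setT setIT => -> gE.
rewrite -(expectation_untreated (measurable_bilin k0 k1 k2 k3 truth_in_model)).
  by rewrite unlock; apply: eq_integral => w _; rewrite gE.
exact: nearW.
Qed.

Lemma prob_untreated a : P (Ya a @^-1` [set true] `&` A @^-1` [set false]) =
  (if a then I 0 1 0 0 else I 0 0 1 0)%:E.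
Proof.
by case: a; apply: (is_cond_prob_untreated (cond_YA _ true false)) => x;
  rewrite /bilin /ea; ring.
Qed.

Lemma outd_falseE a x : outd c0 a false x = 1 - outd c0 a true x.
Proof. by case: (hYa a) => _ _ /(_ x) <-; rewrite addrAC subrr add0r. Qed.

Lemma prob_conditioning : P [set w | ~~ A w && ~~ Y w] = (I 1 0 (- 1) 0)%:E.
Proof.
rewrite (_ : [set w | _] = Ya false @^-1` [set false] `&` A @^-1` [set false]).
  apply: (is_cond_prob_untreated (cond_YA _ false false)) => x.
  by rewrite outd_falseE /bilin /ea; ring.
by apply/seteqP; split => w; rewrite /Ya/= hY; case: (A w); case: (Y0 w) => //= -[].
Qed.

Let sufficient_set : [set w | Y1 w && (~~ A w && ~~ Y w)] =
  (Y0 @^-1` [set false] `&` Y1 @^-1` [set true]) `&` A @^-1` [set false].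
Proof.
apply/seteqP; split => w /=; rewrite hY.
  by case: (A w); case: (Y0 w); case: (Y1 w).
by move=> [[-> ->] ->].
Qed.

(** The event in the numerator is Y0 = 0, Y1 = 1, A = 0. Independence of the potential outcomes,
    then ignorability for the pair, gives it the conditional probability (1 - mu0) mu1 (1 - e). *)
Lemma gamma_indep_identification : cond_indep P X Y0 Y1 ->
  fine (P [set w | Y1 w && (~~ A w && ~~ Y w)]) / fine (P [set w | ~~ A w && ~~ Y w])
  = (mub P X e mu true - mub10 P X e mu) / mubb P X e mu false.
Proof.
move=> Y01; rewrite prob_conditioning mubb_false; congr (_ / _).
have c01 : is_cond_prob P X (Y0 @^-1` [set false] `&` Y1 @^-1` [set true])
    (fun x => f0 false x * f1 true x).
  apply: (cond_indepM mX _ _ Y01); try by move=> b; exact: mpre.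
    by case: hf0 => /(_ false).
  by case: hf1 => /(_ true).
have VE : V @^-1` [set (false, true)] = Y0 @^-1` [set false] `&` Y1 @^-1` [set true].
  by apply/seteqP; split => w; rewrite /V /= => -[-> ->].
rewrite -VE in c01.
have := cond_indepM mX mV (fun b => mpre b mA) ignorability c01 (cond_A false).
rewrite VE -sufficient_set => c2.
rewrite (is_cond_prob_untreated (k0 := 0) (k1 := 1) (k2 := 0) (k3 := - 1) c2) => [/=|x].
  rewrite mub_true mub10E (_ : _ - _ = I 0 1 0 0 + (- 1) * I 0 0 0 1); last by ring.
  rewrite /I -integral_untreatedD; last exact: truth_in_model.
  by apply: eq_Rintegral => x _; rewrite /untreated /bilin; ring.
by rewrite (outd_falseE false : forall x, f0 false x = _) /bilin /ea /c0 /=; ring.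
Qed.

(** By monotonicity the event Y0 = 1, Y1 = 0 is null, so P(Y0 = 0, Y1 = 1, A = 0) is the difference
    of P(Y1 = 1, A = 0) and P(Y0 = 1, A = 0), both given by ignorability. *)
Lemma gamma_mono_identification : {ae P, forall w, Y0 w ==> Y1 w} ->
  fine (P [set w | Y1 w && (~~ A w && ~~ Y w)]) / fine (P [set w | ~~ A w && ~~ Y w])
  = (mub P X e mu true - mub P X e mu false) / mubb P X e mu false.
Proof.
move=> mono; rewrite prob_conditioning mubb_false; congr (_ / _).
pose C y0 y1 := (Y0 @^-1` [set y0] `&` Y1 @^-1` [set y1]) `&` A @^-1` [set false].
have mC y0 y1 : measurable (C y0 y1).
  by apply: measurableI; [apply: measurableI|]; exact: mpre.
have P10 : P (C true false) = 0%E.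
  apply: measure_negligible => //; apply: negligibleS mono.
  by move=> w [[/= H0 H1] _]; rewrite H0 H1.
have P1 : P (Y1 @^-1` [set true] `&` A @^-1` [set false]) =
    (P (C true true) + P (C false true))%E.
  rewrite (_ : _ `&` _ = C true true `|` C false true).
    apply: measureU => //; apply/seteqP; split => w //=.
    by rewrite /C /=; intuition congruence.
  by apply/seteqP; split => w; rewrite /C /=; case: (Y0 w); intuition.
have P0 : P (Y0 @^-1` [set true] `&` A @^-1` [set false]) =
    (P (C true true) + P (C true false))%E.
  rewrite (_ : _ `&` _ = C true true `|` C true false).
    apply: measureU => //; apply/seteqP; split => w //=.
    by rewrite /C /=; intuition congruence.
  by apply/seteqP; split => w; rewrite /C /=; case: (Y1 w); intuition.
have := prob_untreated true; have := prob_untreated false; rewrite /Ya P1 P0 P10 adde0.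
move=> -> /= E; rewrite mub_true mub_false sufficient_set -/(C false true).
have /fineK := fin_num_measure P _ (mC false true) => F.
by move: E; rewrite -F -EFinD => -[<-]; rewrite addrAC subrr add0r.
Qed.

End identification.

(** * From the gradient to the efficiency bound *)

Section efficiency.
Context d d' (U : measurableType d) (T : measurableType d') (R : realType).
Variables (P : probability U R) (nu : {measure set T -> \bar R}).
Variables (Y A : U -> bool) (X : U -> T) (c0 : components T R).
Hypotheses (mY : measurable_fun setT Y) (mA : measurable_fun setT A)
  (mX : measurable_fun setT X).
Hypothesis c0_model : in_model nu c0.
Hypothesis obs_law : forall y a (B : set T), measurable B ->
  P (cell Y A y a `&` X @^-1` B) = (\int[nu]_(x in B) (obs_density c0 y a x)%:E)%E.

Lemma variance_mean0 (h : U -> R) : ('E_P[h] = 0)%E ->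
  ('V_P[h] = 'E_P[fun w => (h w ^+ 2)%R])%E.
Proof.
move=> h0; rewrite /variance covariance.unlock h0 /=.
by congr expectation; apply/funext => w; rewrite -[LHS]/((h w - 0) * (h w - 0)) subr0 expr2.
Qed.

Lemma gradient_efficient (c1 c2 : R) (Gamma : components T R -> R)
    (psi : bool -> bool -> T -> R) :
  \int[nu]_x untreated 1 0 (- 1) 0 c0 x != 0 ->
  (forall c, in_model nu c -> Gamma c = gamma_coef nu c1 c2 c) ->
  (forall y a, measurable_fun setT (psi y a)) ->
  {ae P, forall w, at_obs Y A X (gradient nu c0 c1 c2) w = at_obs Y A X psi w} ->
  [/\ efficient_influence_function P nu Y A X c0 Gamma psi,
      efficiency_bound P nu Y A X c0 Gamma 'V_P[at_obs Y A X psi]%E &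
      ('V_P[at_obs Y A X psi] = 'E_P[fun w => ((at_obs Y A X psi w) ^+ 2)%R])%E].
Proof.
move=> D0 GammaE mpsi psiE.
have ipsi := gradient_influence mY mA mX c0_model obs_law D0 mpsi psiE GammaE.
have eif : efficient_influence_function P nu Y A X c0 Gamma psi.
  split=> //.
    exact: (gradient_in_tangent_space mX c0_model D0 psiE).
  by move=> psi' ipsi' _; exact: influence_function_unique ipsi ipsi'.
split=> //; first by exists psi.
by apply: variance_mean0; case: ipsi.
Qed.

End efficiency.

Theorem theorem5
  (R : realType) (p : nat)
  (d : measure_display) (Omega : measurableType d) (P : probability Omega R)
  (X : {RV P >-> p.-tuple R}) (A Y0 Y1 : {RV P >-> bool})
  (Y : Omega -> bool) (hY : forall w, Y w = if A w then Y1 w else Y0 w)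
  (nu : {sigma_finite_measure set (p.-tuple R) -> \bar R})
  (f : p.-tuple R -> R) (hf : is_density P nu X f)
  (e : p.-tuple R -> R) (he : is_cond_prob P X [set w | A w] e)
  (mu : bool -> p.-tuple R -> R)
  (hmu : is_cond_prob P (fun w => (X w, A w)) [set w | Y w]
           (fun xa => mu xa.2 xa.1))
  (f0 f1 : bool -> p.-tuple R -> R)
  (hf0 : is_cond_pmf P X Y0 f0) (hf1 : is_cond_pmf P X Y1 f1)
  (hpos : (0 < P [set w | ~~ A w && ~~ Y w])%E)
  (ignorability : cond_indep P X (fun w => (Y0 w, Y1 w)) A)
  (positivity : forall x, 0 < e x < 1) :
  let gamma := fine (P [set w | Y1 w && (~~ A w && ~~ Y w)])
               / fine (P [set w | ~~ A w && ~~ Y w]) in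
  let c0 := Components (fun a => if a then f1 else f0) e f in
  let phi := phi_mono P X e mu in
  let varphi := phi_indep P X e mu in
  ({ae P, forall w, Y0 w ==> Y1 w} ->
    [/\ gamma = (mub P X e mu true - mub P X e mu false) / mubb P X e mu false,
        forall y a x, phi y a x = phi_mono_gamma P X e mu gamma y a x,
        efficient_influence_function P nu Y A X c0 (gamma_mono nu) phi,
        efficiency_bound P nu Y A X c0 (gamma_mono nu) 'V_P[at_obs Y A X phi]%E &
        ('V_P[at_obs Y A X phi] =
         'E_P[fun w => ((at_obs Y A X phi w) ^+ 2)%R])%E])
  /\
  (cond_indep P X Y0 Y1 ->
    [/\ gamma = (mub P X e mu true - mub10 P X e mu) / mubb P X e mu false,
        forall y a x, varphi y a x = phi_indep_gamma P X e mu gamma y a x,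
        efficient_influence_function P nu Y A X c0 (gamma_indep nu) varphi,
        efficiency_bound P nu Y A X c0 (gamma_indep nu)
          'V_P[at_obs Y A X varphi]%E &
        ('V_P[at_obs Y A X varphi] =
         'E_P[fun w => ((at_obs Y A X varphi w) ^+ 2)%R])%E]).
Proof.
have mX : measurable_fun setT X by [].
have mA : measurable_fun setT A by [].
have mY0 : measurable_fun setT Y0 by [].
have mY1 : measurable_fun setT Y1 by [].
move=> gamma c0 phi varphi.
have mY := measurable_observed mA mY0 mY1 hY.
have c0_model := truth_in_model hf he hf0 hf1 positivity : in_model nu c0.
have obs_law := observed_law mX mA mY0 mY1 hY hf he hf0 hf1 ignorability positivity.
have muE := outcome_regressionE mX mA mY0 mY1 hY hf he hmu hf0 hf1 ignorability positivity.
have mu1 := mub_true mX mA mY0 mY1 hY hf he hmu hf0 hf1 ignorability positivity.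
have mu0 := mub_false mX mA mY0 mY1 hY hf he hmu hf0 hf1 ignorability positivity.
have mu10 := mub10E mX mA mY0 mY1 hY hf he hmu hf0 hf1 ignorability positivity.
have mubb1 := mubb_true mX mA mY0 mY1 hY hf he hmu hf0 hf1 ignorability positivity.
have mubb0 := mubb_false mX mA mY0 mY1 hY hf he hmu hf0 hf1 ignorability positivity.
have pE := prob_conditioning mX mA mY0 mY1 hY hf he hf0 hf1 ignorability positivity.
rewrite -/c0 in mu1 mu0 mu10 mubb1 mubb0 pE.
(* The denominator is the probability of the conditioning event A = 0, Y = 0. *)
have D0 : mubb P X e mu false != 0.
  by move: hpos; rewrite pE mubb0 lte_fin => /gt_eqF ->.
have me : measurable_fun setT e by case: he.
have mmu := measurable_regression hmu.
have mei : measurable_fun setT (fun x => (e x)^-1).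
  by apply: measurable_ge0_inv => // x; have /andP[/ltW] := positivity x.
have e0 x : e x != 0 by have /andP[/gt_eqF ->] := positivity x.
have D0' : \int[nu]_x untreated 1 0 (- 1) 0 c0 x != 0 by rewrite -mubb0.
(* The coefficients are written with [- 0] here and below so that the right-hand sides are literally
   the numerators of [gamma_coef] at (1, 0) and (0, 1). *)
have I10 : mub P X e mu true - mub P X e mu false =
    \int[nu]_x untreated 0 1 (- 1) (- 0) c0 x.
  rewrite mu1 mu0 -[X in _ + X = _]mulN1r -integral_untreatedD//.
  by apply: eq_Rintegral => x _; rewrite /untreated /bilin; ring.
have I01 : mub P X e mu true - mub10 P X e mu =
    \int[nu]_x untreated 0 1 (- 0) (- 1) c0 x.
  rewrite mu1 mu10 -[X in _ + X = _]mulN1r -integral_untreatedD//.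
  by apply: eq_Rintegral => x _; rewrite /untreated /bilin; ring.
(* From 1 - mu1 = (1 - mu0) - (mu1 - mu0); divided by the denominator, it turns the ratio of the two
   constants into 1 - gamma. *)
have mbb1 : mubb P X e mu true
    = mubb P X e mu false - (mub P X e mu true - mub P X e mu false).
  rewrite I10 mubb1 mubb0 -[X in _ = _ + X]mulN1r -integral_untreatedD//.
  by apply: eq_Rintegral => x _; rewrite /untreated /bilin; ring.
split=> [mono|indep].
- have gammaE : gamma = (mub P X e mu true - mub P X e mu false) / mubb P X e mu false.
    exact: (gamma_mono_identification mX mA mY0 mY1 hY hf he hmu hf0 hf1
      ignorability positivity mono).
  have phiE y a x : phi y a x = phi_mono_gamma P X e mu gamma y a x.
    by rewrite /phi /phi_mono /phi_mono_gamma gammaE mbb1; field; rewrite D0 e0.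
  have mphi y a : measurable_fun setT (phi y a).
    rewrite (_ : phi y a = phi_mono_gamma P X e mu gamma y a); last exact/funext.
    apply: measurable_funD.
      by apply: measurable_funB; repeat (apply: measurable_funM => //);
        exact: measurable_funB.
    do 2![apply: measurable_funM => //]; apply: measurable_funD.
      exact: measurable_funB.
    by apply: measurable_funM => //; exact: measurable_funB.
  (* Off a null set the regressions may be replaced by the components, and the compact form of the
     influence function becomes the gradient by algebra. *)
  have psiE : {ae P, forall w, at_obs Y A X (gradient nu c0 1 0) w = at_obs Y A X phi w}.
    apply: filterS2 (muE true) (muE false) => w E1 E0.
    rewrite /at_obs phiE /phi_mono_gamma /gradient /gamma_coef -I10 -mubb0 -gammaE.
    by rewrite /bilin -E1 -E0 /=; field; rewrite D0 e0.
  have [eif eb V] := gradient_efficient mY mA mX c0_model obs_law D0'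
    (fun c mc => gamma_monoE mc) mphi psiE.
  by split.
- have gammaE : gamma = (mub P X e mu true - mub10 P X e mu) / mubb P X e mu false.
    exact: (gamma_indep_identification mX mA mY0 mY1 hY hf he hmu hf0 hf1
      ignorability positivity indep).
  have phiE y a x : varphi y a x = phi_indep_gamma P X e mu gamma y a x.
    by rewrite /varphi /phi_indep /phi_indep_gamma gammaE; field; rewrite D0 e0.
  have mphi y a : measurable_fun setT (varphi y a).
    rewrite (_ : varphi y a = phi_indep_gamma P X e mu gamma y a); last exact/funext.
    apply: measurable_funD.
      by repeat (apply: measurable_funM => //); exact: measurable_funB.
    do 2![apply: measurable_funM => //]; apply: measurable_funB => //.
    exact: measurable_funM.
  have psiE : {ae P, forall w, at_obs Y A X (gradient nu c0 0 1) w = at_obs Y A X varphi w}.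
    apply: filterS2 (muE true) (muE false) => w E1 E0.
    rewrite /at_obs phiE /phi_indep_gamma /gradient /gamma_coef -I01 -mubb0 -gammaE.
    by rewrite /bilin -E1 -E0 /=; field; rewrite D0 e0.
  have [eif eb V] := gradient_efficient mY mA mX c0_model obs_law D0'
    (fun c mc => gamma_indepE mc) mphi psiE.
  by split.
Qed.
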